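(* Let $(y_t)$ be the $n$-dimensional Gaussian VAR$(p)$ process described in the context, with companion matrix $A^*$, and suppose that all eigenvalues of $A^*$ are different and have modulus less than one. Put $\mu:=[I_n-A_1-\dots-A_p]^{-1}\nu$, $\Gamma(0):=\sum_{i=0}^\infty\Phi_i\Sigma\Phi_i'$ and $$\Gamma:=\sum_{j_1=1}^{\infty}\sum_{j_2=j_1}^{\infty}\Phi_{j_2}\Sigma\Phi_{j_1-1}'.$$ Let $t\ge 0$ be an integer and let $i,i_1,i_2\in\{1,\dots,m\}$. (i) If $$e_i'J_{g,k}\mu+e_i'J_{g,k}\Big(\tfrac12\Gamma(0)+\Gamma\Big)J_{g,k}'e_i<0,$$ then the series $$\sum_{q=1}^\infty \exp\Big\{e_i'\tilde d_t+\mathbb{E}\big(e_i'z_q\big|\mathcal{F}_t\big)+\tfrac12\mathrm{Var}\big(e_i'z_q\big|\mathcal{F}_t\big)\Big\}$$ is convergent. (ii) If $$\max\Big\{e_{i_1}'J_{g,k}\mu+e_{i_1}'J_{g,k}\big(\Gamma(0)+2\Gamma\big)J_{g,k}'e_{i_1},\ \ e_{i_2}'J_{g,k}\mu+e_{i_2}'J_{g,k}\big(\Gamma(0)+2\Gamma\big)J_{g,k}'e_{i_2}\Big\}<0,$$ then the double series $$\sum_{q_1=1}^\infty\sum_{q_2=1}^\infty\exp\Big\{e_{i_1}'\tilde d_t+e_{i_2}'\tilde d_t+\mathbb{E}\big(e_{i_1}'z_{q_1}+e_{i_2}'z_{q_2}\big|\mathcal{F}_t\big)+\tfrac12\mathrm{Var}\big(e_{i_1}'z_{q_1}+e_{i_2}'z_{q_2}\big|\mathcal{F}_t\big)\Big\}$$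 is convergent.
   Context: Let $m\ge1$, $\ell\ge0$, $p\ge1$ be integers and $n:=2m+\ell$. A prime denotes transpose. The process $y_t\in\mathbb{R}^n$ satisfies, for $t=1,2,\dots$, $$y_t=\nu+A_1y_{t-1}+\dots+A_py_{t-p}+\xi_t,$$ where $\nu\in\mathbb{R}^n$, $A_1,\dots,A_p\in\mathbb{R}^{n\times n}$, and $(\xi_t)$ is an $n$-dimensional Gaussian white noise: the $\xi_t\sim\mathcal{N}(0,\Sigma)$ are independent, with positive definite covariance matrix $\Sigma$. The companion matrix is the $np\times np$ matrix $$A^*:=\begin{bmatrix}A_1&\dots&A_{p-1}&A_p\\ I_n&\dots&0&0\\ \vdots&\ddots&\vdots&\vdots\\ 0&\dots&I_n&0\end{bmatrix}$$ (for $p=1$, $A^*=A_1$). Put $y_t^*:=(y_t',\dots,y_{t-p+1}')'\in\mathbb{R}^{np}$, $J:=[I_n:0:\dots:0]\in\mathbb{R}^{n\times np}$, and $\Phi_q:=J(A^* )^qJ'$ for $q\ge0$. The first $m$ components of $y_t$ form the log required rate of return vector $\tilde k_t=J_ky_t$ of $m$ companies, and the next $m$ components form the log dividend growth rate vector $\tilde g_t=J_gy_t$, where $J_k:=[I_m:0:0]$ and $J_g:=[0:I_m:0]$ are $m\times n$ matrices with blocks of widths $m,m,\ell$. Put $J_{g,k}:=J_g-J_k\in\mathbb{R}^{m\times n}$. The log dividend vector $\tilde d_t\in\mathbb{R}^m$ satisfies $\tilde d_t=\tilde d_{t-1}+\tilde g_t$ for $t\ge1$, with initial value $\tilde d_0$.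 The vector $e_i\in\mathbb{R}^m$ is the $i$-th standard unit vector. The information at time $t$ is $\mathcal{F}_t:=\sigma(\tilde d_0,y_0,\dots,y_t)$; the lagged vector $y_t^*$ (including any initial values $y_{-p+1},\dots,y_{-1}$ it contains) is treated as known given $\mathcal{F}_t$, and the noises $\xi_{t+1},\xi_{t+2},\dots$ are independent of $\mathcal{F}_t$. Thus conditional moments are $$\mathbb{E}(y_{t+j}|\mathcal{F}_t)=\sum_{q=1}^j\Phi_{j-q}\nu+J(A^* )^jy_t^*\quad(j>0),\qquad \mathrm{Cov}(y_{t+j_1},y_{t+j_2}|\mathcal{F}_t)=\sum_{q=1}^{\min(j_1,j_2)}\Phi_{j_1-q}\Sigma\Phi_{j_2-q}'\quad(j_1,j_2>0).$$ For fixed $t$ and $q\ge1$, $z_q:=J_{g,k}\sum_{j=1}^qy_{t+j}\in\mathbb{R}^m$. (The first series is the theoretical price $\mathbb{E}(e_i'P_t|\mathcal{F}_t)$ of company $i$ at time $t$ and the second is the mixed moment $\mathbb{E}(e_{i_1}'P_tP_t'e_{i_2}|\mathcal{F}_t)$, where $P_t$ is the vector of stock prices in the Gordon growth model, $P_t=\sum_{q\ge1}\exp\{\sum_{j=1}^q(\tilde g_{t+j}-\tilde k_{t+j})\}\odot\exp\{\tilde d_t\}$ with $\exp$ and the product $\odot$ taken componentwise.) *)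

(* Defs.v *)
From HB Require Import structures.
From mathcomp Require Import all_boot all_order all_algebra.
From mathcomp Require Import complex.
From mathcomp Require Import all_classical all_reals all_analysis.

Set Implicit Arguments.
Unset Strict Implicit.
Unset Printing Implicit Defensive.

Import Order.TTheory GRing.Theory Num.Theory numFieldNormedType.Exports.
Local Open Scope classical_set_scope.
Local Open Scope ring_scope.

Section Spectrum.
Variables (R : realType) (N : nat).
Implicit Type M : 'M[R]_N.

Definition cplx_mx M : 'M[R[i]]_N := map_mx (real_complex R) M.

(* [s] lists the complex eigenvalues with their algebraic multiplicities. *)
Definition distinct_eigenvalues M : Prop :=
  exists s : seq R[i],
    char_poly (cplx_mx M) = \prod_(z <- s) ('X - z%:P) /\ uniq s.

Definition eigenvalues_in_unit_disc M : Prop :=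
  forall z : R[i], eigenvalue (cplx_mx M) z -> `|z| < 1.

Definition posdef M : Prop :=
  M^T = M /\ forall a : 'cV[R]_N, a != 0 -> 0 < (a^T *m M *m a) 0 0.

End Spectrum.

Section VarCoefficients.
Variables (R : realType) (n p : nat).
(* [A j] is the coefficient of lag [j.+1]. *)
Variables (nu : 'cV[R]_n) (A : 'I_p -> 'M[R]_n) (Sigma : 'M[R]_n).

Definition companion : 'M[R]_(\sum_(i < p) n) :=
  \mxblock_(i < p, j < p)
    (if i == 0%N :> nat then A j
     else if i == j.+1 :> nat then 1%:M else 0).

Definition selJ : 'M[R]_(n, \sum_(i < p) n) :=
  \mxrow_(j < p) (if j == 0%N :> nat then 1%:M else 0).

Definition Phi (q : nat) : 'M[R]_n := selJ *m companion ^+ q *m selJ^T.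

Definition var_mean : 'cV[R]_n := invmx (1%:M - \sum_(j < p) A j) *m nu.

Definition Gamma0 : 'M[R]_n :=
  limn (series (fun i => Phi i *m Sigma *m (Phi i)^T)).

(* The outer index is [j1 - 1] and the inner one is [j2 - j1]. *)
Definition Gamma : 'M[R]_n :=
  limn (series (fun j => limn (series (fun k =>
    Phi (j.+1 + k) *m Sigma *m (Phi j)^T)))).

End VarCoefficients.

Section Blocks.
Variables (R : realType) (m l : nat).

Definition Jk : 'M[R]_(m, m + m + l) := row_mx (row_mx 1%:M 0) 0.
Definition Jg : 'M[R]_(m, m + m + l) := row_mx (row_mx 0 1%:M) 0.
Definition Jgk : 'M[R]_(m, m + m + l) := Jg - Jk.

End Blocks.
Arguments Jk {R m l}.
Arguments Jg {R m l}.
Arguments Jgk {R m l}.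

Section Probability.
Context d (T : measurableType d) (R : realType) (P : probability T R).

Definition sigma_vec n (X : T -> 'cV[R]_n) : set (set T) :=
  g_sigma_preimage (fun (i : 'I_n) (w : T) => X w i 0).

Definition sigma_independent (G H : set (set T)) : Prop :=
  forall B C, G B -> H C -> (P (B `&` C) = P B * P C)%E.

(* Conditional expectation in the sigma-integrable sense: the defining identity
   is required on the pieces of a countable G-measurable cover on each of which
   [X] is integrable. For integrable [X] this is the usual notion (take
   [D k = setT]); the extended one is needed because no moment assumption is
   made on the initial values of the process. *)
Definition is_cond_exp (G : set (set T)) (X Y : T -> R) : Prop :=
  preimage_set_system setT Y measurable `<=` G /\
  exists D : (set T)^nat,
    [/\ forall k, G (D k),
        \bigcup_k D k = setT,
        forall k, P.-integrable (D k) (EFin \o X) &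
        forall k B, G B ->
          (\int[P]_(w in B `&` D k) (X w)%:E =
           \int[P]_(w in B `&` D k) (Y w)%:E)%E].

(* A chosen version, unique up to a [P]-null set, of E(X | G). *)
Definition cond_exp (G : set (set T)) (X : T -> R) : T -> R :=
  xget (cst 0) [set Y | is_cond_exp G X Y].

Definition cond_var (G : set (set T)) (X : T -> R) : T -> R :=
  cond_exp G (fun w => (X w - cond_exp G X w) ^+ 2).

(* [X] is N(0, Sigma)-distributed: every nontrivial linear combination
   [a' X] is univariate normal with variance [a' Sigma a]; the second argument
   of [normal_prob] is the standard deviation. *)
Definition centered_gaussian n (Sigma : 'M[R]_n) (X : T -> 'cV[R]_n) : Prop :=
  sigma_vec X `<=` measurable /\
  forall (a : 'cV[R]_n) (B : set R), a != 0 -> measurable B ->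
    P ((fun w => (a^T *m X w) 0 0) @^-1` B) =
    normal_prob 0 (Num.sqrt ((a^T *m Sigma *m a) 0 0)) B.

Definition mutually_independent n (xi : nat -> T -> 'cV[R]_n) (I : set nat) :=
  forall (s : seq nat) (B : nat -> set T), uniq s -> [set` s] `<=` I ->
    (forall k, k \in s -> sigma_vec (xi k) (B k)) ->
    (P (\bigcap_(k in [set` s]) B k) = \prod_(k <- s) P (B k))%E.

Definition gaussian_white_noise n (Sigma : 'M[R]_n)
    (xi : nat -> T -> 'cV[R]_n) : Prop :=
  (forall t, (0 < t)%N -> centered_gaussian Sigma (xi t)) /\
  mutually_independent xi [set t | (0 < t)%N].

Definition future_noise n (xi : nat -> T -> 'cV[R]_n) (t : nat) : set (set T) :=
  <<s \bigcup_(s in [set s | (t < s)%N]) sigma_vec (xi s) >>.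

Definition information m n (dt : nat -> T -> 'cV[R]_m)
    (y : int -> T -> 'cV[R]_n) (t : nat) : set (set T) :=
  <<s sigma_vec (dt 0%N) `|`
      \bigcup_(s in [set s | (s <= t)%N]) sigma_vec (y s%:Z) >>.

Definition lagged n (p : nat) (y : int -> T -> 'cV[R]_n) (t : nat) (w : T) :
    'cV[R]_(\sum_(j < p) n) :=
  \mxcol_(j < p) y (t%:Z - j%:Z) w.

(* Only the values [y s] with [s > - p] and [xi s] with [s > 0] matter. *)
Record gaussian_var n (p : nat) (nu : 'cV[R]_n) (A : 'I_p -> 'M[R]_n)
    (Sigma : 'M[R]_n) (xi : nat -> T -> 'cV[R]_n) (y : int -> T -> 'cV[R]_n) :
    Prop := GaussianVar {
  var_posdef : posdef Sigma ;
  var_noise : gaussian_white_noise Sigma xi ;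
  var_meas : forall s : int, - p%:Z < s -> sigma_vec (y s) `<=` measurable ;
  var_eq : forall t : nat, (0 < t)%N -> forall w : T,
    y t%:Z w = nu + \sum_(j < p) A j *m y (t%:Z - j.+1%:Z) w + xi t w }.

Record log_dividends m l (y : int -> T -> 'cV[R]_(m + m + l))
    (dt : nat -> T -> 'cV[R]_m) : Prop := LogDividends {
  div_meas : sigma_vec (dt 0%N) `<=` measurable ;
  div_eq : forall t : nat, (0 < t)%N -> forall w : T,
    dt t w = dt t.-1 w + Jg *m y t%:Z w }.

Definition zsum m l (y : int -> T -> 'cV[R]_(m + m + l)) (t q : nat) (w : T) :
    'cV[R]_m :=
  Jgk *m \sum_(1 <= j < q.+1) y (t%:Z + j%:Z) w.

Definition price_term m l (y : int -> T -> 'cV[R]_(m + m + l))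
    (dt : nat -> T -> 'cV[R]_m) (t : nat) (i : 'I_m) (q : nat) (w : T) : R :=
  let F := information dt y t in
  let Z := fun w => zsum y t q w i 0 in
  expR (dt t w i 0 + cond_exp F Z w + 2^-1 * cond_var F Z w).

Definition mixed_term m l (y : int -> T -> 'cV[R]_(m + m + l))
    (dt : nat -> T -> 'cV[R]_m) (t : nat) (i1 i2 : 'I_m) (q1 q2 : nat)
    (w : T) : R :=
  let F := information dt y t in
  let Z := fun w => zsum y t q1 w i1 0 + zsum y t q2 w i2 0 in
  expR (dt t w i1 0 + dt t w i2 0 + cond_exp F Z w + 2^-1 * cond_var F Z w).

End Probability.

(* Iterated convergence; for nonnegative terms, as here, this is equivalent to
   every other notion of convergence of a double series. *)
Definition double_series_cvg (R : realType) (u : nat -> nat -> R) : Prop :=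
  (forall k1, cvgn (series (u k1))) /\
  cvgn (series (fun k1 => limn (series (u k1)))).

(* Main.v *)
(* The VAR recursion splits e_k' z_q into an F_t-measurable forecast and a linear
   form in xi_{t+1}, ..., xi_{t+q}.  Hence, almost surely, E(e_k' z_q | F_t) is
   the forecast and Var(e_k' z_q | F_t) is the variance of the linear form, that
   is, the sum over 1 <= j <= q of r S_j Sigma S_j' r', where r is the k-th row of
   J_{g,k} and S_j = Phi_0 + ... + Phi_{j-1}.  The exponents are therefore partial
   sums of a sequence e_j.  Distinct eigenvalues in the open unit disc make the
   powers of the companion matrix decay geometrically, so S_j tends to
   S = (I - A_1 - ... - A_p)^{-1}, the forecasts tend to r mu, and
   S Sigma S' = Gamma(0) + Gamma + Gamma'.  So e_j tends to the quantity assumed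
   negative, and the series is dominated by a geometric one.  For the mixed
   moments, Var(X + Y) <= 2 Var X + 2 Var Y bounds the general term by a product
   of a term in q_1 and a term in q_2, each of the form treated in (i) with the
   variance counted twice. *)
Require Import Defs.
From HB Require Import structures.
From mathcomp Require Import all_boot all_order all_algebra.
From mathcomp Require Import complex.
From mathcomp Require Import all_classical all_reals all_analysis.
From mathcomp Require Import measurable_realfun.
From mathcomp Require Import ring lra zify.

Set Implicit Arguments.
Unset Strict Implicit.
Unset Printing Implicit Defensive.

Import Order.TTheory GRing.Theory Num.Theory numFieldNormedType.Exports.
Import ComplexField.Normc.
Local Open Scope classical_set_scope.
Local Open Scope ring_scope.

(** * Complex modulus and geometric decay of matrix powers *)

Lemma normc_real (R : rcfType) (x : R) : normc (x%:C)%C = `|x|.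
Proof. by rewrite /normc /= expr0n /= addr0 sqrtr_sqr. Qed.

Lemma normcX (R : rcfType) (z : R[i]) q : normc (z ^+ q) = normc z ^+ q.
Proof. by elim: q => [|q IH]; rewrite ?expr0 ?normc1 // !exprS normcM IH. Qed.

Lemma normc_ge0 (R : rcfType) (z : R[i]) : 0 <= normc z.
Proof. by case: z => a b /=; rewrite sqrtr_ge0. Qed.

Lemma normc_sum (R : rcfType) (I : finType) (F : I -> R[i]) :
  normc (\sum_i F i) <= \sum_i normc (F i).
Proof.
elim/big_ind2: _ => [|x1 x2 y1 y2 h1 h2|//]; first by rewrite normc0.
by apply: le_trans (le_normcD _ _) _; rewrite lerD.
Qed.

Lemma diag_conj_exp (F : fieldType) N (P M : 'M[F]_N) (d : 'rV[F]_N) q :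
  P *m M = diag_mx d *m P ->
  P *m M ^+ q = diag_mx (\row_k d 0 k ^+ q) *m P.
Proof.
move=> PM; elim: q => [|q IH].
  rewrite expr0 -[1]/(1%:M) mulmx1.
  suff -> : diag_mx (\row_k d 0 k ^+ 0) = 1%:M by rewrite mul1mx.
  by apply/matrixP => i j; rewrite !mxE expr0.
rewrite exprSr -[_ * M]/(_ *m M) mulmxA IH -mulmxA PM mulmxA; congr (_ *m P).
by rewrite mulmx_diag; congr diag_mx; apply/rowP => k; rewrite !mxE -exprSr.
Qed.

(** The minimal polynomial divides the characteristic one, whose roots are simple, so the matrix is
    diagonalizable over the complex numbers. Each entry of [M ^+ q] is then a fixed combination of
    q-th powers of eigenvalues, and [rho] is their largest modulus. *)
Lemma geometric_powers (R : realType) N (M : 'M[R]_N) :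
  distinct_eigenvalues M -> eigenvalues_in_unit_disc M ->
  exists c rho : R, [/\ 0 <= c, 0 <= rho, rho < 1 &
    forall q a b, `|(M ^+ q) a b| <= c * rho ^+ q].
Proof.
case: N M => [|N] M; first by move=> _ _; exists 0, 0; split=> // q [].
case=> s [Ms s_uniq] Mdisc.
have [P Pu /similar_diagPex [d /(similarP Pu) PM]] : diagonalizable (cplx_mx M).
  apply/diagonalizableP; exists s => //.
  by rewrite -Ms; exact: mxminpoly_dvd_char.
have d1 k : normc (d 0 k) < 1.
  (* Row [k] of [P] is a left eigenvector for [d 0 k], nonzero because [P] is invertible. *)
  have : eigenvalue (cplx_mx M) (d 0 k).
    apply/eigenvalueP; exists (row k P).
      by apply/rowP => j; rewrite -row_mul PM mul_diag_mx !mxE.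
    apply/negP => /eqP; rewrite rowE => /(congr1 (mulmxr (invmx P))) /=.
    rewrite mulmxK // mul0mx => /rowP /(_ k); rewrite !mxE !eqxx => /eqP.
    by rewrite oner_eq0.
  by move/Mdisc; case: (d 0 k) => u v; rewrite normc_def ltcE /= => /andP[].
pose rho := \big[Num.max/0]_k normc (d 0 k).
have rho_ge0 : 0 <= rho by exact: bigmax_ge_id.
have d_rho k : normc (d 0 k) <= rho by exact: le_bigmax.
(* Summing over all [a] and [b] gives one constant that serves every entry. *)
exists (\sum_a \sum_b \sum_k normc (invmx P a k) * normc (P k b)), rho.
split=> //.
- apply: sumr_ge0 => a _; apply: sumr_ge0 => b _; apply: sumr_ge0 => k _.
  by rewrite mulr_ge0 ?normc_ge0.
- by apply/bigmax_ltP; split.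
move=> q a b.
have Mq : cplx_mx (M ^+ q) = invmx P *m (diag_mx (\row_k d 0 k ^+ q) *m P).
  by rewrite -(diag_conj_exp q PM) mulKmx // /cplx_mx rmorphXn.
rewrite -normc_real.
have -> : ((M ^+ q) a b)%:C%C = cplx_mx (M ^+ q) a b by rewrite mxE.
rewrite Mq mxE; apply: le_trans (normc_sum _) _.
apply: (@le_trans _ _ (\sum_k normc (invmx P a k) * normc (P k b) * rho ^+ q)).
  apply: ler_sum => k _; rewrite mul_diag_mx !mxE !normcM normcX mulrCA mulrC.
  apply: ler_wpM2l; first by rewrite mulr_ge0 ?normc_ge0.
  by rewrite lerXn2r // nnegrE ?normc_ge0.
rewrite -mulr_suml; apply: ler_wpM2r; first exact: exprn_ge0.
have G_ge0 a' b' : 0 <= \sum_k normc (invmx P a' k) * normc (P k b').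
  by apply: sumr_ge0 => k _; rewrite mulr_ge0 ?normc_ge0.
rewrite pair_big /= (bigD1 (a, b)) //= lerDl.
by apply: sumr_ge0 => -[a' b'] _; exact: G_ge0.
Qed.

(** * Block structure and resolvent of the companion matrix *)

Section Companion.
Variables (R : realType) (n p : nat) (A : 'I_p -> 'M[R]_n).
Variables (o : 'I_p) (o0 : o = 0%N :> nat).
Local Notation N := (\sum_(i < p) n)%N.
Local Notation C := (companion A).
Local Notation J := (selJ R n p).

(** Here [o] is the block index of value 0; the existence of such an index is the form in which p >=
    1 enters. *)
Lemma mul_selJ k (X : 'M[R]_(N, k)) : J *m X = submxcol X o.
Proof.
rewrite -{1}[X]submxcolK mul_mxrow_mxcol (bigD1 o) //= o0 eqxx mul1mx.
rewrite big1 ?addr0 // => j jo; rewrite ifF ?mul0mx //.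
by apply/negP => /eqP j0; case/eqP: jo; apply/val_inj; rewrite /= o0.
Qed.

Lemma companion_mul0 k (X : 'M[R]_(N, k)) :
  submxcol (C *m X) o = \sum_j A j *m submxcol X j.
Proof.
rewrite /companion mxblockEv mxcol_mul mxcolK -{1}[X]submxcolK.
by rewrite mul_mxrow_mxcol; apply: eq_bigr => j _; rewrite o0.
Qed.

Lemma companion_mulS k (X : 'M[R]_(N, k)) (i j : 'I_p) :
  i = j.+1 :> nat -> submxcol (C *m X) i = submxcol X j.
Proof.
move=> ij; rewrite /companion mxblockEv mxcol_mul mxcolK -{1}[X]submxcolK.
rewrite mul_mxrow_mxcol (bigD1 j) //= ij eqxx mul1mx big1 ?addr0 // => h hj.
rewrite eqSS ifF ?mul0mx //; apply/negP => /eqP /val_inj jh.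
by rewrite jh eqxx in hj.
Qed.

Lemma submxcol_selJT0 : submxcol J^T o = 1%:M.
Proof. by rewrite /selJ tr_mxrow mxcolK o0 eqxx trmx1. Qed.

Lemma submxcol_selJTS (i : 'I_p) : i != 0%N :> nat -> submxcol J^T i = 0.
Proof. by move=> i0; rewrite /selJ tr_mxrow mxcolK (negbTE i0) trmx0. Qed.

(** If I - C were singular, 1 would be an eigenvalue of C, but its modulus is not less than one. *)
Lemma companion_resolvent_unit :
  eigenvalues_in_unit_disc C -> 1%:M - C \in unitmx.
Proof.
move=> Cdisc; rewrite -opprB -scaleN1r unitmxZ ?rpredN ?rpred1 //.
apply: contraT => nu.
have /eigenvalueP [v vC v0] : eigenvalue C 1.
  by rewrite /eigenvalue /eigenspace kermx_eq0 row_free_unit.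
have /Cdisc : eigenvalue (cplx_mx C) 1.
  apply/eigenvalueP; exists (map_mx (real_complex R) v).
    by rewrite /cplx_mx -map_mxM vC scale1r scale1r.
  by rewrite map_mx_eq0.
by rewrite normr1 ltxx.
Qed.

Definition resolvent := invmx (1%:M - C).

(** Finite geometric sum: since [resolvent] times I - C is I, the powers telescope. *)
Lemma sum_companion_powers q : 1%:M - C \in unitmx ->
  \sum_(s < q) C ^+ s = resolvent - resolvent *m C ^+ q.
Proof.
move=> Cu; have BC : resolvent - resolvent *m C = 1%:M.
  by rewrite -{1}[resolvent]mulmx1 -mulmxBr mulVmx.
elim: q => [|q IH]; first by rewrite big_ord0 expr0 mulmx1 subrr.
rewrite big_ord_recr /= IH exprS -[C * _]/(C *m _) mulmxA.
have -> : resolvent *m C *m C ^+ q = resolvent *m C ^+ q - C ^+ q.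
  by rewrite -[X in _ - X]mul1mx -BC mulmxBl opprB addrC subrK.
by rewrite opprB addrA addrAC.
Qed.

Definition Phi_sum q : 'M[R]_n := \sum_(s < q) Phi A s.

(** The S of the outline, the limit of the sums S_q, which are [Phi_sum q]. *)
Definition Phi_lim : 'M[R]_n := J *m resolvent *m J^T.

Lemma Phi_sumE q : 1%:M - C \in unitmx ->
  Phi_sum q = Phi_lim - J *m resolvent *m C ^+ q *m J^T.
Proof.
move=> Cu; rewrite /Phi_sum /Phi -mulmx_suml -mulmx_sumr sum_companion_powers //.
by rewrite mulmxBr mulmxBl !mulmxA.
Qed.

(** The matrix X = [resolvent *m J^T] solves X = C X + J^T. The subdiagonal identities of C force
    all blocks of X to be equal, and the top block row then says that their common value is a right
    inverse of I minus the sum of the A_j. *)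
Lemma Phi_limE : 1%:M - C \in unitmx ->
  Phi_lim = invmx (1%:M - \sum_j A j).
Proof.
move=> Cu; set X := resolvent *m J^T.
have XE : X = C *m X + J^T.
  apply/eqP; rewrite addrC -subr_eq; apply/eqP.
  by rewrite -{1}[X]mul1mx -mulmxBl mulmxA mulmxV // mul1mx.
have Xi (i : 'I_p) : submxcol X i = submxcol X o.
  case: i => i; elim: i => [|i IH] ip; first by congr submxcol; apply/val_inj.
  rewrite -(IH (ltnW ip)) {1}XE submxcolD submxcol_selJTS // addr0.
  exact: companion_mulS.
have X0 : (1%:M - \sum_j A j) *m submxcol X o = 1%:M.
  rewrite mulmxBl mul1mx {1}XE submxcolD companion_mul0 submxcol_selJT0.
  under eq_bigr do rewrite Xi.
  by rewrite -mulmx_suml addrAC subrr add0r.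
have [Du _] := mulmx1_unit X0.
rewrite /Phi_lim -mulmxA -/X mul_selJ.
by rewrite -[LHS](mulKmx Du) X0 mulmx1.
Qed.

End Companion.

(** * Entrywise limits and geometric bounds for matrix sequences *)

Section MatrixSequences.
Variable R : realType.

(** The matrix topology is entrywise, and finitely many eventual conditions hold eventually
    together. *)
Lemma mx_cvgP a b (u : nat -> 'M[R]_(a, b)) (L : 'M[R]_(a, b)) :
  u @ \oo --> L <-> forall i j, (fun q => u q i j) @ \oo --> L i j.
Proof.
split=> [uL i j|uL].
  exact: (cvg_comp u (fun M : 'M[R]_(a, b) => M i j) uL (@coord_continuous _ _ _ i j L)).
move=> B [Q LQ QB].
suff : \forall q \near \oo, forall i j, Q i j (u q i j).
  by apply: filterS => q Qq; apply: QB.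
by apply: filter_forall => i; apply: filter_forall => j; exact: (uL i j _ (LQ i j)).
Qed.

Lemma cvg_fin_sum (I : finType) (f : I -> nat -> R) (l : I -> R) :
  (forall i, f i @ \oo --> l i) ->
  (fun q => \sum_i f i q) @ \oo --> \sum_i l i.
Proof.
move=> fl; elim: (index_enum I) => [|i s IH].
  by under eq_fun do rewrite big_nil; rewrite big_nil; exact: cvg_cst.
by under eq_fun do rewrite big_cons; rewrite big_cons; exact: cvgD.
Qed.

Lemma cvg_mulmx a b c (u : nat -> 'M[R]_(a, b)) (v : nat -> 'M[R]_(b, c))
    (L : 'M[R]_(a, b)) (L' : 'M[R]_(b, c)) :
  u @ \oo --> L -> v @ \oo --> L' ->
  (fun q => u q *m v q) @ \oo --> L *m L'.
Proof.
move=> /mx_cvgP uL /mx_cvgP vL; apply/mx_cvgP => i j; rewrite mxE.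
under eq_fun do rewrite mxE.
by apply: cvg_fin_sum => k; apply: cvgM; [exact: uL|exact: vL].
Qed.

Lemma cvg_trmx a b (u : nat -> 'M[R]_(a, b)) (L : 'M[R]_(a, b)) :
  u @ \oo --> L -> (fun q => (u q)^T) @ \oo --> L^T.
Proof.
move=> /mx_cvgP uL; apply/mx_cvgP => i j; rewrite mxE.
by under eq_fun do rewrite mxE; exact: uL.
Qed.

Definition geometric_mx (rho : R) a b (u : nat -> 'M[R]_(a, b)) :=
  exists2 c, 0 <= c & forall q i j, `|u q i j| <= c * rho ^+ q.

(** A fixed matrix counts as a sequence of ratio 1, so [geometric_mxM] also covers multiplication by
    constants. *)
Lemma geometric_mx_cst a b (M : 'M[R]_(a, b)) : geometric_mx 1 (fun=> M).
Proof.
exists (\sum_ij `|M ij.1 ij.2|); first exact: sumr_ge0.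
move=> q i j; rewrite expr1n mulr1 (bigD1 (i, j)) //= lerDl.
exact: sumr_ge0.
Qed.

Lemma geometric_mxM rho tau a b c
    (u : nat -> 'M[R]_(a, b)) (v : nat -> 'M[R]_(b, c)) :
  geometric_mx rho u -> geometric_mx tau v ->
  geometric_mx (rho * tau) (fun q => u q *m v q).
Proof.
move=> [cu cu0 hu] [cv cv0 hv]; exists (cu * cv *+ b).
  by rewrite mulrn_wge0 // mulr_ge0.
move=> q i j; rewrite mxE; apply: le_trans (ler_norm_sum _ _ _) _.
rewrite -[b in leRHS]card_ord mulrnAl -sumr_const; apply: ler_sum => k _.
by rewrite normrM exprMn mulrACA ler_pM.
Qed.

Lemma geometric_mx_tr rho a b (u : nat -> 'M[R]_(a, b)) :
  geometric_mx rho u -> geometric_mx rho (fun q => (u q)^T).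
Proof. by move=> [c c0 hu]; exists c => // q i j; rewrite mxE. Qed.

Lemma geometric_mxW rho tau a b (u : nat -> 'M[R]_(a, b)) :
  0 <= rho <= tau -> geometric_mx rho u -> geometric_mx tau u.
Proof.
move=> /andP[r0 rt] [c c0 hu]; exists c => // q i j.
apply: le_trans (hu q i j) _; apply: ler_wpM2l => //.
by rewrite lerXn2r // nnegrE // (le_trans r0).
Qed.

Lemma geometric_mx_S rho a b (u : nat -> 'M[R]_(a, b)) :
  0 <= rho -> geometric_mx rho u -> geometric_mx rho (fun q => u q.+1).
Proof.
move=> r0 [c c0 hu]; exists (c * rho); first exact: mulr_ge0.
by move=> q i j; rewrite -mulrA -exprS.
Qed.

Variable rho : R.
Hypotheses (rho_ge0 : 0 <= rho) (rho_lt1 : rho < 1).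

Lemma geometric_mx_cvg0 a b (u : nat -> 'M[R]_(a, b)) :
  geometric_mx rho u -> u @ \oo --> (0 : 'M[R]_(a, b)).
Proof.
move=> [c c0 hu]; apply/mx_cvgP => i j; rewrite mxE; apply: norm_cvg0.
apply: (@squeeze_cvgr _ _ _ _ (cst 0) (geometric c rho)).
- by apply: nearW => q /=; rewrite normr_ge0 hu.
- exact: cvg_cst.
- by apply: cvg_geometric; rewrite ger0_norm.
Qed.

Lemma geometric_mx_series a b (u : nat -> 'M[R]_(a, b)) :
  geometric_mx rho u -> cvgn (series u).
Proof.
move=> [c c0 hu].
have uij i j : cvgn (series (fun q => u q i j)).
  apply: normed_cvg; apply: (@series_le_cvg _ _ (geometric c rho)) => //.
  - by move=> q; exact: normr_ge0.
  - by move=> q; exact: geometric_ge0.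
  - by move=> q; exact: hu.
  - by apply: is_cvg_geometric_series; rewrite ger0_norm.
apply/cvg_ex; exists (\matrix_(i, j) limn (series (fun q => u q i j))).
apply/mx_cvgP => i j; rewrite mxE.
rewrite (_ : (fun q => _) = series (fun q => u q i j)); first exact: uij.
by apply/funext => q; rewrite /series /= summxE.
Qed.

End MatrixSequences.

(** * The identity between Gamma(0), Gamma and the limit of [Phi_sum] *)

Section LongRunCovariance.
Variables (R : realType) (n p : nat) (A : 'I_p -> 'M[R]_n) (Sigma : 'M[R]_n).
Variable rho : R.
Hypotheses (rho_ge0 : 0 <= rho) (rho_lt1 : rho < 1).
Hypothesis Cu : 1%:M - companion A \in unitmx.
Hypothesis C_geo : geometric_mx rho (fun q => companion A ^+ q).

Lemma Phi_geometric : geometric_mx rho (Phi A).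
Proof.
have := geometric_mxM (geometric_mxM (geometric_mx_cst (selJ R n p)) C_geo)
  (geometric_mx_cst (selJ R n p)^T).
by rewrite mul1r mulr1.
Qed.

(** The tail is the power [C ^+ q] multiplied on both sides by fixed matrices. *)
Lemma Phi_tail_geometric : geometric_mx rho (fun q => Phi_lim A - Phi_sum A q).
Proof.
have := geometric_mxM (geometric_mxM
  (geometric_mx_cst (selJ R n p *m resolvent A)) C_geo)
  (geometric_mx_cst (selJ R n p)^T).
rewrite mul1r mulr1; congr geometric_mx; apply/funext => q.
by rewrite Phi_sumE // opprB addrC subrK.
Qed.

Lemma Phi_sum_cvg : Phi_sum A @ \oo --> Phi_lim A.
Proof.
have h := geometric_mx_cvg0 rho_ge0 rho_lt1 Phi_tail_geometric.
rewrite (_ : Phi_sum A = (fun q => Phi_lim A - (Phi_lim A - Phi_sum A q))).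
  rewrite -[X in _ --> X]subr0; apply: cvgB => //; exact: cvg_cst.
by apply/funext => q; rewrite opprB addrC subrK.
Qed.

(** [Gamma0] is a [limn], informative only once its series is known to converge. *)
Lemma Gamma0_cvg :
  series (fun i => Phi A i *m Sigma *m (Phi A i)^T) @ \oo --> Gamma0 A Sigma.
Proof.
(* One decaying factor suffices: the ratio is read as [rho * 1], and the bound on the last factor is
   weakened to ratio 1. *)
apply: (@geometric_mx_series _ rho); rewrite // -[rho]mulr1.
apply: geometric_mxM; last first.
  apply: geometric_mxW (geometric_mx_tr Phi_geometric).
  by rewrite rho_ge0 ltW.
rewrite -[rho]mulr1; apply: geometric_mxM; first exact: Phi_geometric.
exact: geometric_mx_cst.
Qed.

(** The inner partial sums are differences of values of [Phi_sum], so the inner series is a tail S -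
    S_{j+1}. This turns the double series for Gamma into a single one. *)
Lemma Gamma_inner_lim j :
  limn (series (fun k => Phi A (j.+1 + k) *m Sigma *m (Phi A j)^T)) =
  (Phi_lim A - Phi_sum A j.+1) *m Sigma *m (Phi A j)^T.
Proof.
apply: cvg_lim; first exact: norm_hausdorff.
rewrite (_ : series _ = fun q =>
    (Phi_sum A (j.+1 + q) - Phi_sum A j.+1) *m Sigma *m (Phi A j)^T).
  apply: cvg_mulmx; last exact: cvg_cst.
  apply: cvg_mulmx; last exact: cvg_cst.
  apply: cvgB; last exact: cvg_cst.
  under eq_fun do rewrite addnC.
  exact: (cvg_comp _ _ (cvg_addnr j.+1) Phi_sum_cvg).
apply/funext => q; rewrite seriesEord /= -2!mulmx_suml.
congr (_ *m _ *m _).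
by rewrite /Phi_sum big_split_ord /= [RHS]addrC addKr.
Qed.

Lemma Gamma_cvg :
  series (fun j => (Phi_lim A - Phi_sum A j.+1) *m Sigma *m (Phi A j)^T)
    @ \oo --> Gamma A Sigma.
Proof.
rewrite /Gamma; under [X in limn (series X)]eq_fun do rewrite Gamma_inner_lim.
apply: (@geometric_mx_series _ rho); rewrite // -[rho]mulr1.
apply: geometric_mxM; last first.
  apply: geometric_mxW (geometric_mx_tr Phi_geometric).
  by rewrite rho_ge0 ltW.
rewrite -[rho]mulr1; apply: geometric_mxM; last exact: geometric_mx_cst.
exact: geometric_mx_S Phi_tail_geometric.
Qed.

(** [V X] equals L Sigma L^T - (L - X) Sigma (L - X)^T. Its increment when S grows by one term F
    consists of the matching terms of Gamma(0), Gamma and the transpose of Gamma. *)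
Lemma long_run_covariance_step (L S F : 'M[R]_n) : Sigma^T = Sigma ->
  let V := fun X => L *m Sigma *m X^T + X *m Sigma *m L^T - X *m Sigma *m X^T in
  let g := (L - (S + F)) *m Sigma *m F^T in
  F *m Sigma *m F^T + (g + g^T) = V (S + F) - V S.
Proof.
move=> SigmaT V g.
have gT : g^T = F *m Sigma *m L^T - (F *m Sigma *m S^T + F *m Sigma *m F^T).
  rewrite /g !trmx_mul trmxK SigmaT [(L - _)^T]raddfB /= [(S + F)^T]raddfD /=.
  by rewrite mulmxA mulmxBr mulmxDr.
rewrite gT /g /V [(S + F)^T]raddfD /= !mulmxBl !mulmxDl !mulmxDr.
move: (L *m _ *m S^T) (S *m _ *m L^T) (S *m _ *m S^T) (F *m _ *m S^T).
move: (S *m _ *m F^T) (F *m _ *m F^T) (L *m _ *m F^T) (F *m _ *m L^T).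
by move=> a b c d e f g' h; apply/matrixP => i j; rewrite !mxE; lra.
Qed.

(** The increments of the previous lemma telescope, starting from the empty sum, where V
    vanishes. *)
Lemma partial_long_run_covariance q : Sigma^T = Sigma ->
  let S := Phi_sum A in let g := fun j =>
    (Phi_lim A - S j.+1) *m Sigma *m (Phi A j)^T in
  \sum_(j < q) Phi A j *m Sigma *m (Phi A j)^T
    + (\sum_(j < q) g j + (\sum_(j < q) g j)^T) =
  Phi_lim A *m Sigma *m (S q)^T + S q *m Sigma *m (Phi_lim A)^T
    - S q *m Sigma *m (S q)^T.
Proof.
move=> SigmaT S g; elim: q => [|q IH].
  by rewrite /S /Phi_sum !big_ord0 trmx0 !mulmx0 !mul0mx !addr0 subrr.
have SE : S q.+1 = S q + Phi A q by rewrite /S /Phi_sum big_ord_recr.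
rewrite !big_ord_recr /= [(_ + g q)^T]raddfD /=.
have step := long_run_covariance_step (Phi_lim A) (S q) (Phi A q) SigmaT.
have -> : forall a b c d e f : 'M[R]_n,
    a + b + (c + d + (e + f)) = (a + (c + e)) + (b + (d + f)).
  by move=> a b c d e f; apply/matrixP => i j; rewrite !mxE; ring.
by rewrite IH /g SE step addrC subrK.
Qed.

Lemma long_run_covariance : Sigma^T = Sigma ->
  Gamma0 A Sigma + (Gamma A Sigma + (Gamma A Sigma)^T) =
  Phi_lim A *m Sigma *m (Phi_lim A)^T.
Proof.
move=> SigmaT; set L := Phi_lim A; set S := Phi_sum A.
have SL : S @ \oo --> L := Phi_sum_cvg.
set g := fun j => (L - S j.+1) *m Sigma *m (Phi A j)^T.
have gG : series g @ \oo --> Gamma A Sigma := Gamma_cvg.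
apply: (@cvg_unique _ (@norm_hausdorff _ _) ((fun q =>
  L *m Sigma *m (S q)^T + S q *m Sigma *m L^T - S q *m Sigma *m (S q)^T) @ \oo)).
  rewrite (_ : (fun q => _) = fun q =>
    series (fun i => Phi A i *m Sigma *m (Phi A i)^T) q
    + (series g q + (series g q)^T)).
    apply: cvgD; first exact: Gamma0_cvg.
    by apply: cvgD => //; exact: cvg_trmx.
  by apply/funext => q; rewrite !seriesEord -partial_long_run_covariance.
have cL : (fun=> L : 'M[R]_n) @ \oo --> L by exact: cvg_cst.
have cLS : (fun=> L *m Sigma : 'M[R]_n) @ \oo --> L *m Sigma by exact: cvg_cst.
have cSS : (fun q => S q *m Sigma) @ \oo --> L *m Sigma.
  by apply: cvg_mulmx => //; exact: cvg_cst.
(* The limit is written X + X - X, with X = L Sigma L^T, to match the three terms of the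
   sequence. *)
rewrite -(addrK (L *m Sigma *m L^T) (L *m Sigma *m L^T)).
apply: cvgB; last by apply: cvg_mulmx => //; exact: cvg_trmx.
by apply: cvgD; apply: cvg_mulmx => //; exact: cvg_trmx.
Qed.

(** Between [r] and [r^T], Gamma and its transpose give the same 1 x 1 matrix, so [2 *: Gamma] may
    stand for Gamma plus its transpose. *)
Lemma long_run_variance (r : 'rV[R]_n) : Sigma^T = Sigma ->
  (r *m (Gamma0 A Sigma + 2 *: Gamma A Sigma) *m r^T) 0 0 =
  (r *m Phi_lim A *m Sigma *m (r *m Phi_lim A)^T) 0 0.
Proof.
move=> /long_run_covariance; move: (Phi_lim A) => L GE.
have -> : r *m L *m Sigma *m (r *m L)^T = r *m (L *m Sigma *m L^T) *m r^T.
  by rewrite trmx_mul !mulmxA.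
rewrite -GE.
have GT : r *m (Gamma A Sigma)^T *m r^T = (r *m Gamma A Sigma *m r^T)^T.
  by rewrite !trmx_mul trmxK mulmxA.
rewrite scaler_nat mulr2n !mulmxDr !mulmxDl GT.
by move: (r *m Gamma0 A Sigma *m _) (r *m Gamma A Sigma *m _) => X Y; rewrite !mxE.
Qed.

End LongRunCovariance.

(** * Convergence criteria for the single and the double series *)

Section SeriesCriteria.
Variable R : realType.

(** Ratio test: from some rank on, each term is at most [z] = exp(L / 2) < 1 times its
    predecessor. *)
Lemma exp_sum_series_cvg (e : nat -> R) (K L : R) : e @ \oo --> L -> L < 0 ->
  cvgn (series (fun q => expR (K + \sum_(j < q.+1) e j))).
Proof.
move=> eL L0; set u := fun q => expR _; set z := expR (L / 2).
have z0 : 0 < z by exact: expR_gt0.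
have z1 : z < 1 by rewrite -expR0 ltr_expR; lra.
have [N _ eN] : \forall j \near \oo, e j <= L / 2.
  by apply: (cvgr_le _ eL); lra.
(* Each summand secures the bound [u k <= B * z ^+ k] for one k <= N; beyond N the ratio bound
   propagates it. *)
pose B := \sum_(k < N.+1) u k / z ^+ k.
have B0 : 0 <= B.
  by apply: sumr_ge0 => k _; rewrite divr_ge0 ?exprn_ge0 ?expR_ge0 // ltW.
have uB q : u q <= B * z ^+ q.
  elim: q => [|q IH].
    rewrite expr0 mulr1 /B big_ord_recl /= expr0 divr1 lerDl.
    by apply: sumr_ge0 => k _; rewrite divr_ge0 ?exprn_ge0 ?expR_ge0 // ltW.
  have [qN|Nq] := ltnP q N.
    rewrite -ler_pdivrMr ?exprn_gt0 // /B.
    have qN' : (q.+1 < N.+1)%N by [].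
    rewrite (bigD1 (Ordinal qN')) //= lerDl.
    by apply: sumr_ge0 => k _; rewrite divr_ge0 ?exprn_ge0 ?expR_ge0 // ltW.
  rewrite /u big_ord_recr /= addrA expRD exprSr mulrA.
  apply: ler_pM; rewrite ?expR_ge0 //.
  by rewrite ler_expR; apply: eN => /=; rewrite leqW.
apply: (@series_le_cvg _ _ (geometric B z)).
- by move=> q; exact: expR_ge0.
- by move=> q; rewrite geometric_ge0 // ltW.
- exact: uB.
- by apply: is_cvg_geometric_series; rewrite ger0_norm // ltW.
Qed.

(** Comparison is used twice: row [k] is dominated by [v k * w q], and its sum by
    [v k * limn (series w)]. *)
Lemma double_series_cvg_le (u : nat -> nat -> R) (v w : nat -> R) :
  (forall q1 q2, 0 <= u q1 q2 <= v q1 * w q2) ->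
  (forall q, 0 <= v q) -> (forall q, 0 <= w q) ->
  cvgn (series v) -> cvgn (series w) -> double_series_cvg u.
Proof.
move=> uvw v0 w0 cv cw.
have cvw k : cvgn (series (fun q => v k * w q)).
  rewrite (_ : series _ = (fun q => v k * series w q)).
    by apply: is_cvgM; first exact: is_cvg_cst.
  by apply/funext => q; rewrite /series /= mulr_sumr.
have cu k : cvgn (series (u k)).
  apply: (@series_le_cvg _ _ (fun q => v k * w q)) => // q.
  - by have /andP[] := uvw k q.
  - by rewrite mulr_ge0.
  - by have /andP[] := uvw k q.
split=> //; apply: (@series_le_cvg _ _ (fun k => v k * limn (series w))).
- move=> k; apply: limr_ge => //; apply: nearW => q.
  by apply: sumr_ge0 => j _; have /andP[] := uvw k j.
- move=> k; rewrite mulr_ge0 //; apply: limr_ge => //; apply: nearW => q.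
  by apply: sumr_ge0 => j _.
- move=> k; have -> : v k * limn (series w) = limn (series (fun q => v k * w q)).
    apply/esym/cvg_lim => //.
    rewrite (_ : series _ = (fun q => v k * series w q)).
      by apply: cvgM; first exact: cvg_cst.
    by apply/funext => q; rewrite /series /= mulr_sumr.
  by apply: lim_series_le => // q; have /andP[] := uvw k q.
- rewrite (_ : series _ = (fun q => series v q * limn (series w))).
    by apply: is_cvgM; last exact: is_cvg_cst.
  by apply/funext => q; rewrite /series /= mulr_suml.
Qed.

End SeriesCriteria.

(** * Solving the VAR recursion forward from time t *)

Section Trajectory.
Variables (R : realType) (d : measure_display) (T : measurableType d) (n p : nat).
Variables (nu : 'cV[R]_n) (A : 'I_p -> 'M[R]_n).
Variables (xi : nat -> T -> 'cV[R]_n) (y : int -> T -> 'cV[R]_n).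
Variables (o : 'I_p) (o0 : o = 0%N :> nat).
Hypothesis y_eq : forall t : nat, (0 < t)%N -> forall w : T,
  y t%:Z w = nu + \sum_(j < p) A j *m y (t%:Z - j.+1%:Z) w + xi t w.
Local Notation C := (companion A).
Local Notation J := (selJ R n p).

(** The top block is the VAR equation at time t + 1; the other blocks shift the lags by one, as the
    subdiagonal identities of C do. *)
Lemma lagged_recursion t w :
  lagged p y t.+1 w = C *m lagged p y t w + J^T *m (nu + xi t.+1 w).
Proof.
apply/mxcolP => i; rewrite mxcolK submxcolD -[submxcol (J^T *m _) i]submxcol_mul.
have [i0|i0] := eqVneq (i : nat) 0%N.
  have -> : i = o by apply/val_inj; rewrite /= o0.
  rewrite (companion_mul0 _ o0) (submxcol_selJT0 _ _ o0) mul1mx o0 subr0 y_eq //.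
  rewrite addrAC addrC; congr (_ + _); apply: eq_bigr => j _.
  by rewrite mxcolK; congr (_ *m y _ _); lia.
have ip : (i.-1 < p)%N by apply: leq_ltn_trans (ltn_ord i); rewrite leq_pred.
rewrite submxcol_selJTS // mul0mx addr0.
rewrite (@companion_mulS _ _ _ _ _ _ _ (Ordinal ip)) /=; last by lia.
by rewrite mxcolK; congr (y _ _) => /=; lia.
Qed.

Lemma lagged_iterated t j w :
  lagged p y (t + j) w = C ^+ j *m lagged p y t w
    + \sum_(k < j) C ^+ (j - k.+1) *m (J^T *m (nu + xi (t + k.+1)%N w)).
Proof.
elim: j => [|j IH]; first by rewrite addn0 expr0 mul1mx big_ord0 addr0.
rewrite addnS lagged_recursion IH mulmxDr mulmxA -[C *m _]/(C * _) -exprS.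
rewrite -addrA; congr (_ + _); rewrite big_ord_recr /= subnn expr0 mul1mx.
rewrite addnS mulmx_sumr; congr (_ + _); apply: eq_bigr => k _.
by rewrite mulmxA -[C *m _]/(C * _) -exprS subSS -subSn.
Qed.

Lemma forecast_decomposition t j w :
  y (t%:Z + j%:Z) w = J *m C ^+ j *m lagged p y t w
    + \sum_(k < j) Phi A (j - k.+1) *m (nu + xi (t + k.+1)%N w).
Proof.
have -> : y (t%:Z + j%:Z) w = J *m lagged p y (t + j) w.
  by rewrite (mul_selJ o0) mxcolK o0 subr0 PoszD.
rewrite lagged_iterated mulmxDr mulmxA; congr (_ + _).
by rewrite mulmx_sumr; apply: eq_bigr => k _; rewrite /Phi !mulmxA.
Qed.

(** The noise-free part of y at time t + j + 1: the index [j] starts at 0. *)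
Definition forecast t j w := J *m C ^+ j.+1 *m lagged p y t w + Phi_sum A j.+1 *m nu.

Lemma sum_forecast_decomposition t q w :
  \sum_(1 <= j < q.+1) y (t%:Z + j%:Z) w =
  \sum_(j < q) forecast t j w
    + \sum_(k < q) Phi_sum A (q - k) *m xi (t + k.+1)%N w.
Proof.
elim: q => [|q IH]; first by rewrite big_geq // !big_ord0 addr0.
have S0 : Phi_sum A 0 = 0 by rewrite /Phi_sum big_ord0.
have SS k : Phi_sum A k.+1 = Phi_sum A k + Phi A k.
  by rewrite /Phi_sum big_ord_recr.
rewrite big_nat_recr //= IH forecast_decomposition [X in _ = X + _]big_ord_recr /=.
have -> : \sum_(k < q.+1) Phi A (q.+1 - k.+1) *m (nu + xi (t + k.+1)%N w) =
    Phi_sum A q.+1 *m nu + \sum_(k < q.+1) Phi A (q - k) *m xi (t + k.+1)%N w.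
  under eq_bigr do rewrite subSS mulmxDr.
  rewrite big_split /= -mulmx_suml; congr (_ *m _ + _).
  rewrite /Phi_sum (reindex_inj rev_ord_inj) /=.
  by apply: eq_bigr => k _; congr Phi; have := ltn_ord k; lia.
have -> : \sum_(k < q.+1) Phi_sum A (q.+1 - k) *m xi (t + k.+1)%N w =
    \sum_(k < q) Phi_sum A (q - k) *m xi (t + k.+1)%N w
    + \sum_(k < q.+1) Phi A (q - k) *m xi (t + k.+1)%N w.
  (* The term k = q may be added because [Phi_sum A 0] is an empty sum; both sums then have the same
     range. *)
  have -> : \sum_(k < q) Phi_sum A (q - k) *m xi (t + k.+1)%N w =
      \sum_(k < q.+1) Phi_sum A (q - k) *m xi (t + k.+1)%N w.
    by rewrite big_ord_recr /= subnn S0 mul0mx addr0.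
  rewrite -big_split /=; apply: eq_bigr => k _.
  by rewrite -mulmxDl -SS subSn // -ltnS.
rewrite /forecast -!addrA; congr (_ + _).
by rewrite [LHS]addrCA; congr (_ + _); rewrite [LHS]addrCA.
Qed.

End Trajectory.

(** * Expectation of a product of independent variables *)

Section IndependentProduct.
Context d (T : measurableType d) (R : realType) (P : probability T R).
Variables (X Y : {mfun T >-> R}).
Hypothesis XY_indep : forall B C : set R, measurable B -> measurable C ->
  (P (X @^-1` B `&` Y @^-1` C) = P (X @^-1` B) * P (Y @^-1` C))%E.

(** Independence says that the joint law and the product of the marginal laws agree on rectangles,
    hence everywhere; Fubini then separates the factors. *)
Lemma integral_mul_independent :
  P.-integrable setT (EFin \o X) -> P.-integrable setT (EFin \o Y) ->
  P.-integrable setT (fun w => (X w * Y w)%:E) ->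
  (\int[P]_w (X w * Y w)%:E = (\int[P]_w (X w)%:E) * (\int[P]_w (Y w)%:E))%E.
Proof.
move=> iX iY iXY.
have mphi : measurable_fun setT (fun w => (X w, Y w)) by exact: measurable_fun_pair.
pose phi : {mfun T >-> (R * R)%type} :=
  HB.pack (fun w => (X w, Y w)) (isMeasurableFun.Build _ _ _ _ _ mphi).
pose f : (R * R)%type -> \bar R := fun z => (z.1 * z.2)%:E.
have mf : measurable_fun [set: (R * R)%type] f.
  by apply/measurable_EFinP; apply: measurable_funM.
have mE : measurable_fun setT (EFin : R -> \bar R) by exact/measurable_EFinP.
have jointE B : measurable B ->
    (distribution P X \x distribution P Y)%E B = distribution P phi B.
  by apply: product_measure_unique => B' C' mB mC; exact: XY_indep.
have pX : (distribution P X).-integrable setT EFin.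
  by apply: integrable_pushforward => //; rewrite preimage_setT.
have pY : (distribution P Y).-integrable setT EFin.
  by apply: integrable_pushforward => //; rewrite preimage_setT.
have EX : (\int[P]_w (X w)%:E = \int[distribution P X]_x x%:E)%E.
  by rewrite integral_pushforward // preimage_setT.
have EY : (\int[P]_w (Y w)%:E = \int[distribution P Y]_x x%:E)%E.
  by rewrite integral_pushforward // preimage_setT.
have pf : (distribution P phi).-integrable setT f.
  by apply: integrable_pushforward => //; rewrite preimage_setT.
have pf' : (distribution P X \x distribution P Y)%E.-integrable setT f.
  apply/integrableP; split=> //; case/integrableP: pf => _.
  congr (_ < _)%E; apply/esym; apply: eq_measure_integral => B mB _; exact: jointE.
have -> : (\int[P]_w (X w * Y w)%:E = \int[distribution P phi]_z f z)%E.
  by rewrite integral_pushforward // preimage_setT.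
have -> : (\int[distribution P phi]_z f z =
    \int[distribution P X \x distribution P Y]_z f z)%E.
  by apply/esym; apply: eq_measure_integral => B mB _; exact: jointE.
rewrite -integral12_prod_meas1 // /fubini_F /f EX EY /=.
have fY : (\int[distribution P Y]_x x%:E)%E \is a fin_num.
  exact: integrable_fin_num.
under eq_integral do (under eq_integral do rewrite EFinM; rewrite integralZl //).
by rewrite -(fineK fY) integralZr.
Qed.

End IndependentProduct.

(** * An upper bound for the second moment of a normal law *)

Section NormalSecondMoment.
Variable R : realType.
Local Notation mu := (@lebesgue_measure R).

(** The Radon-Nikodym derivative of the normal law agrees almost everywhere with [normal_pdf], since
    both have the same integral over every measurable set. *)
Lemma ge0_integral_normal_prob (s : R) (f : R -> \bar R) :
  (forall x, (0 <= f x)%E) -> measurable_fun setT f ->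
  (\int[normal_prob 0 s]_x f x = \int[mu]_x (f x * (normal_pdf 0 s x)%:E))%E.
Proof.
move=> f0 mf; have dom := @normal_prob_dominates R 0 s.
rewrite -(Radon_Nikodym_SigmaFinite.change_of_variables dom) //.
have mpdf : measurable_fun setT (fun x => (normal_pdf 0 s x)%:E).
  by apply/measurable_EFinP; exact: measurable_normal_pdf.
have idx := Radon_Nikodym_SigmaFinite.f_integrable dom.
apply: ae_eq_integral => //.
- by apply: emeasurable_funM => //; exact: measurable_int idx.
- exact: emeasurable_funM.
apply: ae_eqe_mul2l; apply: integral_ae_eq => // E _ mE.
by rewrite -Radon_Nikodym_SigmaFinite.f_integral.
Qed.

Lemma normal_peak_ratio (s t : R) : 0 < s -> 0 < t ->
  normal_peak s = t / s * normal_peak t.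
Proof.
move=> s0 t0; rewrite /normal_peak -!mulrnAr.
rewrite (sqrtrM _ (sqr_ge0 s)) (sqrtrM _ (sqr_ge0 t)).
by rewrite !sqrtr_sqr !gtr0_norm // !invfM mulrCA -!mulrA mulKf ?gt_eqF // mulrC.
Qed.

(* With h = (s^-2 - t^-2) / 2, this is h x^2 <= exp (h x^2) - 1 times the
   density; integrated over x, it bounds the second moment by
   2 s t^2 / (t + s) for every t > s. *)
Lemma sqr_normal_pdf_le (s t x : R) : 0 < s -> s < t ->
  x ^+ 2 * normal_pdf 0 s x <=
  ((s ^- 2 - t ^- 2) / 2)^-1 * (t / s * normal_pdf 0 t x - normal_pdf 0 s x).
Proof.
move=> s0 st; have t0 := lt_trans s0 st.
rewrite !normal_pdfE ?gt_eqF //; set h := (_ - _) / 2.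
have h0 : 0 < h.
  by rewrite divr_gt0 // subr_gt0 ltf_pV2 ?posrE ?exprn_gt0 // ltrXn2r ?nnegrE ?ltW.
rewrite ler_pdivlMl // [t / s * _]mulrA -normal_peak_ratio // -mulrBr.
have -> : h * (x ^+ 2 * (normal_peak s * normal_fun 0 s x)) =
  normal_peak s * (h * x ^+ 2 * normal_fun 0 s x) by ring.
rewrite ler_pM2l ?normal_peak_gt0 ?gt_eqF // /normal_fun subr0.
have -> : - x ^+ 2 / (t ^+ 2 *+ 2) = h * x ^+ 2 + - x ^+ 2 / (s ^+ 2 *+ 2).
  by rewrite /h -(mulr_natr (t ^+ 2)) -(mulr_natr (s ^+ 2)); field; rewrite !gt_eqF.
rewrite expRD -[X in _ <= _ - X]mul1r -mulrBl.
by rewrite ler_pM2r ?expR_gt0 // lerBrDl expR_ge1Dx.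
Qed.

(** Comparison with a wider normal density of deviation t > s gives a bound that tends to s^2 as t
    decreases to s. An inequality is enough because the exponents of the series are only bounded
    from above. *)
Lemma normal_second_moment (s : R) : 0 < s ->
  (\int[normal_prob 0 s]_x (x ^+ 2)%:E <= (s ^+ 2)%:E)%E.
Proof.
move=> s0.
have mX2 : measurable_fun setT (fun x : R => (x ^+ 2)%:E).
  by apply/measurable_EFinP; exact: measurable_funX.
rewrite ge0_integral_normal_prob //; last by move=> x; rewrite lee_fin sqr_ge0.
have bound t : s < t ->
    (\int[mu]_x ((x ^+ 2)%:E * (normal_pdf 0 s x)%:E) <=
     (2 * s * t ^+ 2 / (t + s))%:E)%E.
  move=> st; have t0 := lt_trans s0 st.
  set h := (s ^- 2 - t ^- 2) / 2.
  have h0 : 0 < h.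
    by rewrite divr_gt0 // subr_gt0 ltf_pV2 ?posrE ?exprn_gt0 // ltrXn2r ?nnegrE ?ltW.
  pose g x :=
    (h^-1%:E * ((t / s)%:E * (normal_pdf 0 t x)%:E - (normal_pdf 0 s x)%:E))%E.
  have ns : mu.-integrable setT (fun x => (normal_pdf 0 s x)%:E).
    exact: integrable_normal_pdf.
  have it : mu.-integrable setT (fun x => ((t / s)%:E * (normal_pdf 0 t x)%:E)%E).
    by apply: integrableZl => //; exact: integrable_normal_pdf.
  (* Both densities have mass 1, so the integral of [g] is h^-1 (t / s - 1). *)
  have -> : (2 * s * t ^+ 2 / (t + s))%:E = (\int[mu]_x g x)%E.
    rewrite integralZl //; last exact: integrableB.
    rewrite integralB // integralZl //; last exact: integrable_normal_pdf.
    rewrite !integral_normal_pdf mule1 -EFinB -EFinM; congr EFin.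
    by rewrite /h; field; rewrite !gt_eqF //; nra.
  apply: ge0_le_integral => //.
  - by move=> x _; rewrite mule_ge0 ?lee_fin ?sqr_ge0 ?normal_pdf_ge0.
  - by apply: emeasurable_funM => //; apply/measurable_EFinP; exact: measurable_normal_pdf.
  - apply: (measurable_int mu); apply: integrableZl => //; exact: integrableB.
  - by move=> x _; rewrite -[leLHS]EFinM lee_fin; exact: sqr_normal_pdf_le.
apply/lee_addgt0Pr => e e0; rewrite -EFinD.
(* At t = s + u the bound exceeds s^2 by (3 s^2 u + 2 s u^2) / (2 s + u), which is at most u (2 s +
   1) when u <= 1. *)
pose u := Num.min 1 (e / (2 * s + 1)).
have c0 : 0 < 2 * s + 1 by lra.
have u0 : 0 < u by rewrite lt_min ltr01 divr_gt0.
have u1 : u <= 1 by rewrite ge_min lexx.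
have ue : u * (2 * s + 1) <= e by rewrite -ler_pdivlMr // ge_min lexx orbT.
apply: (le_trans (bound (s + u) _)); first by lra.
rewrite lee_fin ler_pdivrMr; last by lra.
by nra.
Qed.

End NormalSecondMoment.

(** * Measurability with respect to a generated sigma-algebra *)

Section SubSigmaAlgebra.
Context d (T : measurableType d) (R : realType) (G0 : set (set T)).

(** Putting the smaller sigma-algebra on the source type makes the closure properties of measurable
    functions available for it. *)
Lemma generated_measurable_funP (X : T -> R) :
  preimage_set_system setT X measurable `<=` <<s G0>> <->
  measurable_fun [set: g_sigma_algebraType G0] (X : g_sigma_algebraType G0 -> R).
Proof.
split=> [h _ B mB|h _ [B mB <-]]; first by apply: h; exists B.
exact: (h measurableT B mB).
Qed.

Lemma generated_measurable_fun_sub (X : T -> R) : <<s G0>> `<=` measurable ->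
  measurable_fun [set: g_sigma_algebraType G0] (X : g_sigma_algebraType G0 -> R) ->
  measurable_fun [set: T] X.
Proof. by move=> sub mX _ B mB; apply: sub; exact: (mX measurableT B mB). Qed.

End SubSigmaAlgebra.

(** * Almost sure uniqueness of conditional expectations *)

Section ConditionalExpectation.
Context d (T : measurableType d) (R : realType) (P : probability T R).
Variable G0 : set (set T).
Hypothesis G0_sub : <<s G0>> `<=` measurable.
Local Notation G := <<s G0>>.
Local Notation TG := (g_sigma_algebraType G0).

(* [is_cond_exp] does not ask [Y] to be integrable on the pieces of its cover;
   the sets [V] below also truncate both versions. *)
Lemma cond_exp_version_ge (X Y Y' : T -> R) :
  is_cond_exp P G X Y -> is_cond_exp P G X Y' -> {ae P, forall w, Y' w <= Y w}.
Proof.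
move=> [/generated_measurable_funP mY [D [GD Dcov _ intY]]].
move=> [/generated_measurable_funP mY' [D' [GD' D'cov _ intY']]].
pose V k j n : set T := D k `&` D' j `&`
  ([set w | `|Y w| <= n%:R] `&` [set w | `|Y' w| <= n%:R] `&` [set w | Y w < Y' w]).
have GB (f : T -> R) n : measurable_fun [set: TG] (f : TG -> R) ->
    G [set w | `|f w| <= n%:R].
  move=> mf; have mnf : measurable_fun [set: TG] (fun w => `|(f : TG -> R) w|).
    exact: measurableT_comp.
  have := measurable_fun_ler mnf (measurable_cst (n%:R : R)).
  by move=> /(_ measurableT [set true] I); rewrite setTI.
have GL : G [set w | Y w < Y' w].
  have /(_ measurableT [set true] I) := measurable_fun_ltr mY mY'.
  by rewrite setTI.
have GI (B C : set T) : G B -> G C -> G (B `&` C).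
  by move=> GB' GC'; exact: (@measurableI _ TG).
have GV k j n : G (V k j n).
  exact: (GI _ _ (GI _ _ (GD k) (GD' j))
    (GI _ _ (GI _ _ (GB _ n mY) (GB _ n mY')) GL)).
have mT := generated_measurable_fun_sub G0_sub.
have V0 k j n : P.-negligible (V k j n).
  have iB (f : T -> R) : measurable_fun setT f ->
      (forall w, V k j n w -> `|f w| <= n%:R) ->
      P.-integrable (V k j n) (fun w => (f w)%:E).
    move=> mf fn; have mV := G0_sub (GV k j n).
    apply: (le_integrable mV _ _ (finite_measure_integrable_cst P (n%:R : R) mV)).
      by apply/measurable_EFinP; exact: measurable_funTS.
    by move=> w Vw; rewrite /= lee_fin normr_nat; exact: fn.
  have VD : V k j n `&` D k = V k j n.
    by apply: setIidl => w [[]].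
  have VD' : V k j n `&` D' j = V k j n.
    by apply: setIidl => w [[]].
  have iY := iB _ (mT _ _ mY) (fun w Vw => Vw.2.1.1).
  have iY' := iB _ (mT _ _ mY') (fun w Vw => Vw.2.1.2).
  (* Over [V k j n] both versions have the integral of [X], so the difference, positive there,
     integrates to 0 and the set is negligible. *)
  have diff0 : (\int[P]_(w in V k j n) ((Y' w)%:E - (Y w)%:E) = 0)%E.
    rewrite integralB //; last exact: G0_sub.
    have := intY k _ (GV k j n); rewrite VD => <-.
    have := intY' j _ (GV k j n); rewrite VD' => intE.
    by rewrite intE subee // integrable_fin_num //; exact: G0_sub.
  have : ae_eq P (V k j n) (fun w => (Y' w)%:E - (Y w)%:E)%E (cst 0%E).
    apply/ae_eq_integral_abs; first exact: G0_sub.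
      apply: emeasurable_funB; apply/measurable_EFinP/measurable_funTS.
        exact: mT.
      exact: mT.
    rewrite -diff0; apply: eq_integral => w; rewrite inE => -[_ [_ YY']].
    by rewrite -EFinB /= ger0_norm // subr_ge0 ltW.
  apply: negligibleS => w Vw /= /(_ Vw) /eqP.
  by rewrite -EFinB eqe subr_eq0 gt_eqF //; case: Vw => _ [].
have : {ae P, forall w, forall k j n, ~ V k j n w}.
  apply/ae_foralln => k; apply/ae_foralln => j; apply/ae_foralln => n.
  by apply: negligibleS (V0 k j n) => w /= /contrapT.
apply: filterS => w Vw; rewrite leNgt; apply/negP => YY'.
have [k _ Dk] : (\bigcup_k D k) w by rewrite Dcov.
have [j _ Dj] : (\bigcup_j D' j) w by rewrite D'cov.
pose n := maxn (Num.truncn `|Y w|).+1 (Num.truncn `|Y' w|).+1.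
apply: (Vw k j n); split; first by split.
split=> //; split=> /=; apply: (le_trans (ltW (truncnS_gt _))).
  by rewrite ler_nat leq_maxl.
by rewrite ler_nat leq_maxr.
Qed.

(** Exhibiting one version makes the choice by [xget] a version too; the two then bound each other
    almost surely. *)
Lemma cond_exp_ae (X Y : T -> R) : is_cond_exp P G X Y ->
  is_cond_exp P G X (cond_exp P G X) /\ {ae P, forall w, cond_exp P G X w = Y w}.
Proof.
move=> XY; have XE : is_cond_exp P G X (cond_exp P G X).
  exact: (@xgetPex _ (cst 0) [set Z | is_cond_exp P G X Z] (ex_intro _ Y XY)).
split=> //; apply: filterS2 (cond_exp_version_ge XY XE) (cond_exp_version_ge XE XY).
by move=> w h1 h2; apply/eqP; rewrite eq_le h1 h2.
Qed.

End ConditionalExpectation.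

(** * Conditional moments of a known part plus an independent part *)

Section IndependentRemainder.
Context d (T : measurableType d) (R : realType) (P : probability T R).
Variables G0 H0 : set (set T).
Hypotheses (G0_sub : <<s G0>> `<=` measurable) (H0_sub : <<s H0>> `<=` measurable).
Hypothesis GH_indep : sigma_independent P <<s G0>> <<s H0>>.
Local Notation G := <<s G0>>.
Local Notation TG := (g_sigma_algebraType G0).
Local Notation TH := (g_sigma_algebraType H0).

(** The product rule for independent variables, applied to the indicator of [B] and to [N]. *)
Lemma integral_independent_set (B : set T) (N : T -> R) :
  G B -> measurable_fun [set: TH] (N : TH -> R) ->
  P.-integrable setT (EFin \o N) ->
  (\int[P]_(w in B) (N w)%:E = P B * \int[P]_w (N w)%:E)%E.
Proof.
move=> GB mN iN; have mB := G0_sub GB.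
have mN' := generated_measurable_fun_sub H0_sub mN.
have mX : measurable_fun setT (\1_B : T -> R) by exact: measurable_indic.
pose X : {mfun T >-> R} := HB.pack (\1_B : T -> R)
  (isMeasurableFun.Build _ _ _ _ _ mX).
pose Y : {mfun T >-> R} := HB.pack N (isMeasurableFun.Build _ _ _ _ _ mN').
have iB : P.-integrable setT (EFin \o X).
  exact: integrable_indic.
have iBN : P.-integrable setT (fun w => (X w * Y w)%:E).
  apply: (le_integrable measurableT _ _ iN).
    by apply/measurable_EFinP; exact: measurable_funM.
  move=> w _; rewrite /= lee_fin normrM indicE.
  by case: (w \in B); rewrite ?normr1 ?mul1r // normr0 mul0r.
have XY : forall B' C : set R, measurable B' -> measurable C ->
    (P (X @^-1` B' `&` Y @^-1` C) = P (X @^-1` B') * P (Y @^-1` C))%E.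
  move=> B' C mB' mC; apply: GH_indep.
    have mBG : measurable_fun [set: TG] (\1_B : TG -> R).
      by apply: measurable_indic.
    by have := mBG measurableT B' mB'; rewrite setTI.
  by have := mN measurableT C mC; rewrite setTI.
rewrite -[X in (X * _)%E](_ : (\int[P]_w (X w)%:E = P B)%E); last first.
  by rewrite integral_indic // setIT.
rewrite -(integral_mul_independent XY) // integral_mkcond.
apply: eq_integral => w _; rewrite patchE /= indicE.
by case: ifPn => _; rewrite ?mul1r ?mul0r.
Qed.

(** On a probability space 1 + N^2 is integrable, and it dominates |N|. *)
Lemma sqr_integrable (N : T -> R) : measurable_fun setT N ->
  P.-integrable setT (fun w => (N w ^+ 2)%:E) -> P.-integrable setT (EFin \o N).
Proof.
move=> mN iN2.
have i1 : P.-integrable setT (fun w => (1 + N w ^+ 2)%:E).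
  rewrite (_ : (fun _ => _) = (fun w => 1%:E + (N w ^+ 2)%:E)%E) //.
  by apply: integrableD => //; exact: finite_measure_integrable_cst.
apply: (le_integrable measurableT _ _ i1); first exact/measurable_EFinP.
move=> w _; rewrite /= lee_fin [leRHS]ger0_norm ?addr_ge0 ?sqr_ge0 //.
by rewrite -real_normK ?num_real //; have := sqr_ge0 (`|N w| - 1); nra.
Qed.

Variables Y N : T -> R.
Hypotheses (mY : measurable_fun [set: TG] (Y : TG -> R))
  (mN : measurable_fun [set: TH] (N : TH -> R))
  (iN2 : P.-integrable setT (fun w => (N w ^+ 2)%:E))
  (EN0 : (\int[P]_w (N w)%:E = 0)%E).

(** [Y] need not be integrable, so the cover consists of the sets where |Y| <= n. On each piece [N]
    contributes a probability times its mean, which is 0. *)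
Lemma is_cond_exp_add_independent : is_cond_exp P G (fun w => Y w + N w) Y.
Proof.
have mY' := generated_measurable_fun_sub G0_sub mY.
have mN' := generated_measurable_fun_sub H0_sub mN.
have iN := sqr_integrable mN' iN2.
split; first exact/generated_measurable_funP.
pose D n : set T := [set w | `|Y w| <= n%:R].
have GD n : G (D n).
  have mnY : measurable_fun [set: TG] (fun w => `|(Y : TG -> R) w|).
    exact: measurableT_comp.
  have := measurable_fun_ler mnY (measurable_cst (n%:R : R)).
  by move=> /(_ measurableT [set true] I); rewrite setTI.
have iYD B n : measurable B -> P.-integrable (B `&` D n) (EFin \o Y).
  move=> mB; have mBD := measurableI _ _ mB (G0_sub (GD n)).
  apply: (le_integrable mBD _ _ (finite_measure_integrable_cst P (n%:R : R) mBD)).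
    by apply/measurable_EFinP; exact: measurable_funTS.
  by move=> w [_ Dw]; rewrite /= lee_fin normr_nat.
have iND B : measurable B -> P.-integrable B (EFin \o N).
  by move=> mB; exact: integrableS iN.
exists D; split=> //.
- apply/seteqP; split=> // w _; exists (Num.truncn `|Y w|).+1 => //=.
  exact/ltW/truncnS_gt.
- move=> n; have := iYD setT n measurableT; rewrite setTI => iY.
  rewrite (_ : _ \o _ = (fun w => (Y w)%:E + (N w)%:E)%E) //.
  by apply: integrableD => //; [exact: G0_sub|apply: iND; exact: G0_sub].
- move=> n B GB; have GBD : G (B `&` D n) 
    by exact: (@measurableI _ TG _ _ GB (GD n)).
  have mBD := G0_sub GBD.
  under eq_integral do rewrite EFinD.
  rewrite integralD //; first last.
  + exact: iND.
  + by apply: iYD; exact: G0_sub.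
  by rewrite [X in (_ + X)%E](integral_independent_set GBD mN iN) EN0 mule0 adde0.
Qed.

(** The chosen conditional expectation is almost surely [Y], so the squared deviation is almost
    surely N^2. This is independent of G, and its conditional expectation is therefore its mean. *)
Lemma cond_moments_add_independent :
  {ae P, forall w, cond_exp P G (fun w => Y w + N w) w = Y w /\
    cond_var P G (fun w => Y w + N w) w = fine (\int[P]_w (N w ^+ 2)%:E)}.
Proof.
set X := fun w => Y w + N w; set v := fine _.
have mY' := generated_measurable_fun_sub G0_sub mY.
have mN' := generated_measurable_fun_sub H0_sub mN.
have [[/generated_measurable_funP mCE _] aeCE] :=
  cond_exp_ae G0_sub is_cond_exp_add_independent.
have mCE' := generated_measurable_fun_sub G0_sub mCE.
have mX : measurable_fun setT X by exact: measurable_funD.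
pose W w := (X w - cond_exp P G X w) ^+ 2.
have mW : measurable_fun setT (EFin \o W).
  by apply/measurable_EFinP; apply: measurable_funX; exact: measurable_funB.
have mN2 : measurable_fun setT (fun w => (N w ^+ 2)%:E).
  by apply/measurable_EFinP; exact: measurable_funX.
have WN B : measurable B -> 
    (\int[P]_(w in B) (W w)%:E = \int[P]_(w in B) (N w ^+ 2)%:E)%E.
  move=> mB; apply: ae_eq_integral => //; try exact: measurable_funTS.
  by apply: filterS aeCE => w CEw _; rewrite /W CEw /X addrC addKr.
have mN2H : measurable_fun [set: TH] (fun w => (N : TH -> R) w ^+ 2).
  exact: measurable_funX.
have fv : (\int[P]_w (N w ^+ 2)%:E)%E \is a fin_num by exact: integrable_fin_num.
have WE : is_cond_exp P G W (cst v).
  split; first by apply/generated_measurable_funP; exact: measurable_cst.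
  exists (fun=> setT); split.
  - by move=> _; exact: (@measurableT _ TG).
  - by rewrite bigcup_const //; exists 0%N.
  - move=> _; apply/integrableP; split=> //.
    under eq_integral do rewrite gee0_abs ?lee_fin ?sqr_ge0 //.
    by rewrite WN // -(fineK fv) ltry.
  - move=> _ B GB; rewrite setIT WN; last exact: G0_sub.
    rewrite (integral_independent_set GB mN2H iN2) muleC -(fineK fv) -/v.
    by rewrite -(integral_cst _ (G0_sub GB)).
have [_ aeCV] := cond_exp_ae G0_sub WE.
by apply: filterS2 aeCE aeCV => w h1 h2; split.
Qed.

End IndependentRemainder.

(** * Second moments of sums *)

Section OrthogonalSum.
Context d (T : measurableType d) (R : realType) (P : probability T R).

Lemma mul_integrable (X Y : T -> R) :
  measurable_fun setT X -> measurable_fun setT Y ->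
  P.-integrable setT (fun w => (X w ^+ 2)%:E) ->
  P.-integrable setT (fun w => (Y w ^+ 2)%:E) ->
  P.-integrable setT (fun w => (X w * Y w)%:E).
Proof.
move=> mX mY iX iY.
have iXY := integrableD measurableT iX iY.
apply: (le_integrable measurableT _ _ iXY).
  by apply/measurable_EFinP; exact: measurable_funM.
move=> w _; rewrite -EFinD /= lee_fin [leRHS]ger0_norm ?addr_ge0 ?sqr_ge0 //.
rewrite normrM -[X w ^+ 2]real_normK ?num_real // -[Y w ^+ 2]real_normK ?num_real //.
by have := sqr_ge0 (`|X w| - `|Y w|); have := normr_ge0 (X w);
   have := normr_ge0 (Y w); nra.
Qed.

Variables (q : nat) (f : 'I_q -> T -> R).
Hypothesis mf : forall k, measurable_fun setT (f k).
Hypothesis if2 : forall k, P.-integrable setT (fun w => (f k w ^+ 2)%:E).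
Hypothesis f0 : forall k, (\int[P]_w (f k w)%:E = 0)%E.
Hypothesis f_orth : forall k l, k != l -> (\int[P]_w (f k w * f l w)%:E = 0)%E.

Let N w := \sum_k f k w.

Let N2E w : ((N w ^+ 2)%:E = \sum_k \sum_l (f k w * f l w)%:E)%E.
Proof.
rewrite expr2 /N mulr_suml -sumEFin; apply: eq_bigr => k _.
by rewrite mulr_sumr sumEFin.
Qed.

Let ifM k l : P.-integrable setT (fun w => (f k w * f l w)%:E).
Proof. exact: mul_integrable. Qed.

Lemma orthogonal_sum_sqr_integrable : P.-integrable setT (fun w => (N w ^+ 2)%:E).
Proof.
rewrite (funext N2E); apply: integrable_sum => // k _.
by apply: integrable_sum => // l _; exact: ifM.
Qed.

Lemma orthogonal_sum_mean : (\int[P]_w (N w)%:E = 0)%E.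
Proof.
under eq_integral do rewrite /N -sumEFin.
rewrite integral_sum //; first by rewrite big1.
by move=> k; apply: sqr_integrable.
Qed.

(** Pythagoras: the off-diagonal terms of [N2E] integrate to 0. *)
Lemma orthogonal_sum_sqr :
  (\int[P]_w (N w ^+ 2)%:E = \sum_k \int[P]_w (f k w ^+ 2)%:E)%E.
Proof.
under eq_integral do rewrite N2E.
rewrite integral_sum //; last first.
  by move=> k; apply: integrable_sum => // l _; exact: ifM.
apply: eq_bigr => k _; rewrite integral_sum //.
rewrite (bigD1 k) //= big1 ?adde0; last by move=> l kl; rewrite f_orth // eq_sym.
by apply: eq_integral => w _; rewrite expr2.
Qed.

End OrthogonalSum.

(** From (X - Y)^2 >= 0. It spares the covariance of the two forecast errors in the mixed moment. *)
Lemma fine_sqr_addr_le d (T : measurableType d) (R : realType)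
    (P : probability T R) (X Y : T -> R) :
  measurable_fun setT X -> measurable_fun setT Y ->
  P.-integrable setT (fun w => (X w ^+ 2)%:E) ->
  P.-integrable setT (fun w => (Y w ^+ 2)%:E) ->
  P.-integrable setT (fun w => ((X w + Y w) ^+ 2)%:E) /\
  fine (\int[P]_w ((X w + Y w) ^+ 2)%:E) <=
  2 * fine (\int[P]_w (X w ^+ 2)%:E) + 2 * fine (\int[P]_w (Y w ^+ 2)%:E).
Proof.
move=> mX mY iX iY.
have iX2 : P.-integrable setT (fun w => 2%:E * (X w ^+ 2)%:E)%E by exact: integrableZl.
have iY2 : P.-integrable setT (fun w => 2%:E * (Y w ^+ 2)%:E)%E by exact: integrableZl.
have i2 := integrableD measurableT iX2 iY2.
have le2 w : (X w + Y w) ^+ 2 <= 2 * X w ^+ 2 + 2 * Y w ^+ 2.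
  by have := sqr_ge0 (X w - Y w); nra.
have m2 : measurable_fun setT (fun w => ((X w + Y w) ^+ 2)%:E).
  by apply/measurable_EFinP; apply: measurable_funX; exact: measurable_funD.
have iXY : P.-integrable setT (fun w => ((X w + Y w) ^+ 2)%:E).
  apply: (le_integrable measurableT _ _ i2) => // w _.
  rewrite -!EFinM -EFinD /= lee_fin !ger0_norm ?sqr_ge0 //.
  by rewrite addr_ge0 // mulr_ge0 // sqr_ge0.
split=> //.
rewrite -lee_fin EFinD !EFinM !fineK; try exact: integrable_fin_num.
rewrite -!integralZl // -integralD //; apply: ge0_le_integral => //.
- by move=> w _; rewrite lee_fin sqr_ge0.
- exact: measurable_int i2.
- by move=> w _; rewrite -!EFinM -EFinD lee_fin.
Qed.

(** * Moments of a linear form in one Gaussian vector *)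

Section GaussianLinearForms.
Context d (T : measurableType d) (R : realType) (P : probability T R).
Variables (n : nat) (Sigma : 'M[R]_n) (X : T -> 'cV[R]_n).
Hypothesis Sigma_pd : posdef Sigma.

Lemma sigma_vec_linear_form (Y : T -> 'cV[R]_n) G0 (r : 'rV[R]_n) :
  sigma_vec Y `<=` <<s G0>> ->
  measurable_fun [set: g_sigma_algebraType G0]
    (fun w : g_sigma_algebraType G0 => (r *m Y w) 0 0).
Proof.
move=> YG; under eq_fun do rewrite mxE.
apply: measurable_sum => k; apply: measurable_funM => //.
apply/generated_measurable_funP => B YB; apply: YG.
by apply: sub_sigma_algebra; rewrite (bigD1 k) //=; left.
Qed.

Hypothesis X_gauss : centered_gaussian P Sigma X.
Let U (r : 'rV[R]_n) w : R := (r *m X w) 0 0.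
Let v (r : 'rV[R]_n) : R := (r *m Sigma *m r^T) 0 0.

Lemma linear_form_measurable r : measurable_fun setT (U r).
Proof.
have h := @sigma_vec_linear_form X _ r (fun B XB => XB).
by apply: (generated_measurable_fun_sub X_gauss.1 h).
Qed.

Local Notation PF r := (@pushforward _ _ T (measurableTypeR R) R P (U r)).

Let law r : r != 0 -> forall f : R -> \bar R,
  (\int[PF r]_x f x = \int[normal_prob 0%R (Num.sqrt (v r))]_x f x)%E.
Proof.
move=> r0 f.
pose V : {mfun T >-> measurableTypeR R} := HB.pack (U r)
  (isMeasurableFun.Build _ _ T (measurableTypeR R) _ (linear_form_measurable r)).
apply: (@eq_measure_integral _ _ R setT (normal_prob 0 (Num.sqrt (v r)))
  (distribution P V) f) => B mB _.
have rT0 : r^T != 0 by rewrite trmx_eq0.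
by have := X_gauss.2 r^T B rT0 mB; rewrite trmxK.
Qed.

Variable r : 'rV[R]_n.

(** For nonzero [r] positive definiteness gives a normal law of positive variance. The case r = 0 is
    separate, since [centered_gaussian] speaks of nonzero combinations and a row r S_j can
    vanish. *)
Lemma linear_form_sqr :
  P.-integrable setT (fun w => (U r w ^+ 2)%:E) /\
  fine (\int[P]_w (U r w ^+ 2)%:E) <= v r.
Proof.
have mU := linear_form_measurable r.
have [r0|r0] := eqVneq r 0.
  have UE w : U r w = 0 by rewrite /U r0 mul0mx mxE.
  under eq_fun do rewrite UE expr0n; rewrite /v r0 !mul0mx mxE.
  by split; [exact: finite_measure_integrable_cst|rewrite integral0].
have s0 : 0 < v r.
  by have := Sigma_pd.2 r^T; rewrite trmxK trmx_eq0; exact.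
have mX2 : measurable_fun setT (fun x : R => (x ^+ 2)%:E).
  by apply/measurable_EFinP; exact: measurable_funX.
have le : (\int[P]_w (U r w ^+ 2)%:E <= (v r)%:E)%E.
  have -> : (\int[P]_w (U r w ^+ 2)%:E = \int[PF r]_x (x ^+ 2)%:E)%E.
    rewrite ge0_integral_pushforward ?preimage_setT //.
    by move=> x _; rewrite lee_fin sqr_ge0.
  rewrite law //.
  by rewrite (le_trans (normal_second_moment _)) ?sqrtr_gt0 // sqr_sqrtr // ltW.
have fin : (\int[P]_w (U r w ^+ 2)%:E)%E \is a fin_num.
  rewrite ge0_fin_numE; first exact: le_lt_trans le (ltry _).
  by apply: integral_ge0 => w _; rewrite lee_fin sqr_ge0.
split; last by rewrite -lee_fin fineK.
apply/integrableP; split.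
  by apply/measurable_EFinP; exact: measurable_funX.
under eq_integral do rewrite gee0_abs ?lee_fin ?sqr_ge0 //.
by rewrite -(fineK fin) ltry.
Qed.

(* The forms r X and - r X have the same law. *)
Lemma linear_form_mean : (\int[P]_w (U r w)%:E = 0)%E.
Proof.
have mU := linear_form_measurable r.
have [r0|r0] := eqVneq r 0.
  have UE w : U r w = 0 by rewrite /U r0 mul0mx mxE.
  by under eq_integral do rewrite UE; rewrite integral0.
have iU := sqr_integrable mU linear_form_sqr.1.
have VE w : U (- r) w = - U r w by rewrite /U mulNmx mxE.
have mV : measurable_fun setT (U (- r)) by exact: linear_form_measurable.
have iV : P.-integrable setT (EFin \o U (- r)).
  rewrite (_ : EFin \o U (- r) = (fun w => - (U r w)%:E)%E); first exact: integrableN.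
  by apply/funext => w; rewrite /= VE.
have mE : measurable_fun setT (EFin : R -> \bar R) by exact/measurable_EFinP.
have EU : (\int[P]_w (U r w)%:E = \int[PF r]_x x%:E)%E.
  by rewrite integral_pushforward ?preimage_setT.
have EV : (\int[P]_w (U (- r) w)%:E = \int[PF (- r)]_x x%:E)%E.
  by rewrite integral_pushforward ?preimage_setT.
have UV : (\int[P]_w (U r w)%:E = \int[P]_w (U (- r) w)%:E)%E.
  have Nr0 : - r != 0 by rewrite oppr_eq0.
  have vN : v (- r) = v r by rewrite /v linearN /= !mulNmx mulmxN opprK.
  have lawN := law Nr0 EFin; rewrite vN in lawN.
  exact: etrans EU (etrans (law r0 EFin) (etrans (esym lawN) (esym EV))).
have : (\int[P]_w (U (- r) w)%:E = - \int[P]_w (U r w)%:E)%E.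
  under eq_integral do rewrite VE EFinN.
  by rewrite integralN //; exact: integrable_add_def.
rewrite -UV; have fU : (\int[P]_w (U r w)%:E)%E \is a fin_num by exact: integrable_fin_num.
by rewrite -(fineK fU) -EFinN => -[] e; congr EFin; lra.
Qed.

End GaussianLinearForms.

(** * Moments of linear forms in the future noise *)

Section FutureNoise.
Context d (T : measurableType d) (R : realType) (P : probability T R).
Variables (n : nat) (Sigma : 'M[R]_n) (xi : nat -> T -> 'cV[R]_n).
Hypotheses (Sigma_pd : posdef Sigma) (noise : gaussian_white_noise P Sigma xi).

Lemma white_noise_orthogonal (s s' : nat) (r r' : 'rV[R]_n) :
  (0 < s)%N -> (0 < s')%N -> s != s' ->
  (\int[P]_w ((r *m xi s w) ord0 ord0 * (r' *m xi s' w) ord0 ord0)%:E = 0)%E.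
Proof.
move=> s0 s'0 ss'.
have [gs gs'] := (noise.1 s s0, noise.1 s' s'0).
have mU := linear_form_measurable gs r; have mU' := linear_form_measurable gs' r'.
pose U : {mfun T >-> R} := HB.pack (fun w => (r *m xi s w) 0 0)
  (isMeasurableFun.Build _ _ _ _ _ mU).
pose U' : {mfun T >-> R} := HB.pack (fun w => (r' *m xi s' w) 0 0)
  (isMeasurableFun.Build _ _ _ _ _ mU').
have [iU _] := linear_form_sqr Sigma_pd gs r.
have [iU' _] := linear_form_sqr Sigma_pd gs' r'.
have ind : forall B C : set R, measurable B -> measurable C ->
    (P (U @^-1` B `&` U' @^-1` C) = P (U @^-1` B) * P (U' @^-1` C))%E.
  move=> B C mB mC.
  have sU : sigma_vec (xi s) (U @^-1` B).
    have := @sigma_vec_linear_form _ _ _ _ (xi s) _ r (fun B XB => XB).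
    by move=> /(_ measurableT B mB); rewrite setTI.
  have sU' : sigma_vec (xi s') (U' @^-1` C).
    have := @sigma_vec_linear_form _ _ _ _ (xi s') _ r' (fun B XB => XB).
    by move=> /(_ measurableT C mC); rewrite setTI.
  (* Mutual independence is used on the list of the two distinct times, with one event for each. *)
  pose D k := if k == s then U @^-1` B else U' @^-1` C.
  have := noise.2 [:: s; s'] D; rewrite !big_cons big_nil mule1 /D eqxx.
  rewrite [s' == s]eq_sym (negbTE ss') => <-.
  - congr (P _); apply/seteqP; split=> w.
      move=> [Bw Cw] k /=; rewrite !inE => /orP[|] /eqP ->; rewrite ?eqxx //.
      by rewrite eq_sym (negbTE ss').
    move=> h; split.
      by have := h s; rewrite /= eqxx; apply; rewrite !inE eqxx.
    by have := h s'; rewrite /= eq_sym (negbTE ss'); apply; rewrite !inE eqxx orbT.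
  - by rewrite /= inE ss'.
  - by move=> k /=; rewrite !inE => /orP[|] /eqP ->.
  - by move=> k; rewrite !inE => /orP[|] /eqP ->; rewrite ?eqxx // eq_sym (negbTE ss').
rewrite (@integral_mul_independent _ _ _ _ U U' ind).
- by rewrite (linear_form_mean Sigma_pd gs) mul0e.
- exact: sqr_integrable.
- exact: sqr_integrable.
- exact: mul_integrable.
Qed.

Variables (t q : nat) (r : 'I_q -> 'rV[R]_n).
Let N w : R := \sum_k (r k *m xi (t + k.+1)%N w) 0 0.

Lemma future_noise_sub : future_noise xi t `<=` measurable.
Proof.
apply: smallest_sub; first exact: sigma_algebra_measurable.
by move=> B [s /= ts]; apply: (noise.1 s _).1; exact: leq_ltn_trans ts.
Qed.

Lemma future_noise_measurable :
  measurable_fun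
    [set: g_sigma_algebraType (\bigcup_(s in [set s | (t < s)%N]) sigma_vec (xi s))]
    (N : g_sigma_algebraType _ -> R).
Proof.
apply: measurable_sum => k; apply: sigma_vec_linear_form => B XB.
apply: sub_sigma_algebra; exists (t + k.+1)%N => //=.
by rewrite addnS ltnS leq_addr.
Qed.

(** Noises at distinct times are orthogonal, so second moments add; the inequality is that of
    [linear_form_sqr]. *)
Lemma future_noise_moments :
  [/\ P.-integrable setT (fun w => (N w ^+ 2)%:E),
      (\int[P]_w (N w)%:E = 0)%E &
      fine (\int[P]_w (N w ^+ 2)%:E) <= \sum_k (r k *m Sigma *m (r k)^T) 0 0].
Proof.
have pos (k : 'I_q) : (0 < t + k.+1)%N by rewrite addnS.
pose f (k : 'I_q) w : R := (r k *m xi (t + k.+1)%N w) 0 0.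
have mf k : measurable_fun setT (f k).
  exact: linear_form_measurable (noise.1 _ (pos k)) (r k).
have if2 k := linear_form_sqr Sigma_pd (noise.1 _ (pos k)) (r k).
have f0 k := linear_form_mean Sigma_pd (noise.1 _ (pos k)) (r k).
have orth (k l : 'I_q) : k != l -> (\int[P]_w (f k w * f l w)%:E = 0)%E.
  by move=> kl; apply: white_noise_orthogonal => //; rewrite eqn_add2l eqSS.
split.
- by apply: orthogonal_sum_sqr_integrable => // k; exact: (if2 k).1.
- by apply: (orthogonal_sum_mean mf) => // k; exact: (if2 k).1.
- rewrite (orthogonal_sum_sqr mf (fun k => (if2 k).1) orth).
  rewrite -sum_fine; last by move=> k _; apply: integrable_fin_num => //; exact: (if2 k).1.
  by apply: ler_sum => k _; exact: (if2 k).2.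
Qed.

End FutureNoise.

(** * Exponents of the price series and the two convergence statements *)

Section StockPrice.
Context (d : measure_display) (T : measurableType d) (R : realType) (P : probability T R).
Variables (m l p : nat) (p_ge1 : (1 <= p)%N).
Variables (nu : 'cV[R]_(m + m + l)) (A : 'I_p -> 'M[R]_(m + m + l)).
Variables (Sigma : 'M[R]_(m + m + l)) (xi : nat -> T -> 'cV[R]_(m + m + l)).
Variables (y : int -> T -> 'cV[R]_(m + m + l)) (dt : nat -> T -> 'cV[R]_m).
Hypothesis y_var : gaussian_var P nu A Sigma xi y.
Hypothesis dt_div : log_dividends y dt.
Hypothesis xi_indep : forall s : nat,
  sigma_independent P (information dt y s) (future_noise xi s).
Hypothesis A_distinct : distinct_eigenvalues (companion A).
Hypothesis A_stable : eigenvalues_in_unit_disc (companion A).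
Variable t : nat.
Hypothesis lagged_known : sigma_vec (lagged p y t) `<=` information dt y t.

Local Notation row_k k := (row k (Jgk : 'M[R]_(m, m + m + l))).
Local Notation Fgen := (sigma_vec (dt 0%N) `|`
  \bigcup_(s in [set s | (s <= t)%N]) sigma_vec (y s%:Z)).

Let forecast_mean (k : 'I_m) q w : R :=
  \sum_(j < q) (row_k k *m forecast nu A y t j w) 0 0.
Let forecast_error (k : 'I_m) q w : R :=
  \sum_(j < q) (row_k k *m Phi_sum A (q - j) *m xi (t + j.+1)%N w) 0 0.
(** The increment of the variance bound: passing from q - 1 to q adds the term with j = q. *)
Let variance_term (k : 'I_m) j : R :=
  (row_k k *m Phi_sum A j *m Sigma *m (row_k k *m Phi_sum A j)^T) 0 0.

Let zsumE k q w : zsum y t q w k 0 = forecast_mean k q w + forecast_error k q w.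
Proof.
rewrite /zsum.
have -> : forall X : 'cV[R]_(m + m + l), (Jgk *m X) k 0 = (row_k k *m X) 0 0.
  by move=> X; rewrite -row_mul [RHS]mxE.
rewrite (@sum_forecast_decomposition _ _ _ _ _ nu A xi y (Ordinal p_ge1) erefl
  (var_eq y_var)).
rewrite mulmxDr mxE !mulmx_sumr !summxE; congr (_ + _).
by apply: eq_bigr => j _; rewrite mulmxA.
Qed.

Let information_sub : <<s Fgen>> `<=` measurable.
Proof.
apply: smallest_sub; first exact: sigma_algebra_measurable.
move=> B [|[s /= _]]; first exact: (div_meas dt_div).
by apply: (var_meas y_var); lia.
Qed.

(** The forecast is affine in [lagged p y t], which is F_t-measurable by [lagged_known]. *)
Let forecast_mean_measurable k q :
  measurable_fun [set: g_sigma_algebraType Fgen]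
    (forecast_mean k q : g_sigma_algebraType Fgen -> R).
Proof.
apply: measurable_sum => j; rewrite (_ : (fun w => _) = fun w =>
    (row_k k *m (selJ R (m + m + l) p *m companion A ^+ j.+1) *m lagged p y t w) 0 0
    + (row_k k *m (Phi_sum A j.+1 *m nu)) 0 0); last first.
  by apply/funext => w; rewrite /forecast mulmxDr mxE !mulmxA.
by apply: measurable_funD => //; exact: sigma_vec_linear_form.
Qed.

Let forecast_error_moments k q :
  [/\ P.-integrable setT (fun w => (forecast_error k q w ^+ 2)%:E),
      (\int[P]_w (forecast_error k q w)%:E = 0)%E &
      fine (\int[P]_w (forecast_error k q w ^+ 2)%:E) <=
        \sum_(j < q) variance_term k j.+1].
Proof.
have [h1 h2 h3] := future_noise_moments (var_posdef y_var) (var_noise y_var)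
  t (fun j : 'I_q => row_k k *m Phi_sum A (q - j)).
split=> //; apply: (le_trans h3).
(* Reversing the index replaces the coefficients S_{q-j}, which depend on q, by S_{j+1}, so the
   bounds are partial sums of a single sequence. *)
rewrite [leRHS](reindex_inj rev_ord_inj) /=; apply: ler_sum => j _.
by rewrite /variance_term subnSK.
Qed.

Let noise_sub : future_noise xi t `<=` measurable :=
  @future_noise_sub _ _ _ _ _ _ _ (var_noise y_var) t.

Let forecast_error_future k q :
  measurable_fun [set: g_sigma_algebraType
      (\bigcup_(s in [set s | (t < s)%N]) sigma_vec (xi s))]
    (forecast_error k q : g_sigma_algebraType _ -> R).
Proof. exact: future_noise_measurable. Qed.

Let forecast_error_measurable k q : measurable_fun setT (forecast_error k q).
Proof.
exact: (generated_measurable_fun_sub noise_sub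
  (forecast_error_future k q)).
Qed.

Let price_moments k q : {ae P, forall w,
  cond_exp P (information dt y t) (fun w => zsum y t q w k 0) w =
    forecast_mean k q w /\
  cond_var P (information dt y t) (fun w => zsum y t q w k 0) w <=
    \sum_(j < q) variance_term k j.+1}.
Proof.
have [h1 h2 h3] := forecast_error_moments k q.
have := cond_moments_add_independent information_sub noise_sub (@xi_indep t)
  (forecast_mean_measurable k q)
  (forecast_error_future k q) h1 h2.
rewrite (funext (zsumE k q)); apply: filterS => w [-> ->]; split=> //.
Qed.

Let mixed_moments k1 k2 q1 q2 :
  let Z := fun w => zsum y t q1 w k1 0 + zsum y t q2 w k2 0 in
  {ae P, forall w,
    cond_exp P (information dt y t) Z w = forecast_mean k1 q1 w + forecast_mean k2 q2 w /\
    cond_var P (information dt y t) Z w <=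
      2 * (\sum_(j < q1) variance_term k1 j.+1)
      + 2 * (\sum_(j < q2) variance_term k2 j.+1)}.
Proof.
move=> Z; have [h1 h2 h3] := forecast_error_moments k1 q1.
have [h1' h2' h3'] := forecast_error_moments k2 q2.
have [i12 le12] := fine_sqr_addr_le (forecast_error_measurable k1 q1)
  (forecast_error_measurable k2 q2) h1 h1'.
have e12 : (\int[P]_w (forecast_error k1 q1 w + forecast_error k2 q2 w)%:E = 0)%E.
  under eq_integral do rewrite EFinD.
  rewrite integralD //; [by rewrite h2 h2' adde0| |];
    exact: sqr_integrable (forecast_error_measurable _ _) _.
have := cond_moments_add_independent information_sub noise_sub (@xi_indep t)
 
  (measurable_funD (forecast_mean_measurable k1 q1) (forecast_mean_measurable k2 q2))
  (measurable_funD (forecast_error_future k1 q1) (forecast_error_future k2 q2))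
  i12 e12.
have -> : Z = fun w => (forecast_mean k1 q1 w + forecast_mean k2 q2 w)
    + (forecast_error k1 q1 w + forecast_error k2 q2 w).
  by apply/funext => w; rewrite /Z !zsumE addrACA.
apply: filterS => w [-> ->]; split=> //; apply: (le_trans le12).
by rewrite lerD // ler_pM2l.
Qed.

(** The weight [c] of the variance is 1/2 for the price series and 1 for the mixed one. *)
Let exponent_cvg (c : R) k w :
  (fun j => (row_k k *m forecast nu A y t j w) 0 0 + c * variance_term k j.+1)
    @ \oo --> (Jgk *m var_mean nu A) k 0
      + c * (Jgk *m (Gamma0 A Sigma + 2 *: Gamma A Sigma) *m Jgk^T) k k.
Proof.
have [b [rho [_ rho0 rho1 C_geo]]] := geometric_powers A_distinct A_stable.
have Cu := companion_resolvent_unit A_stable.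
have Cg : geometric_mx rho (fun q => companion A ^+ q).
  by exists (Num.max 0 b); [rewrite le_max lexx|move=> q i j;
    apply: le_trans (C_geo q i j) _; rewrite ler_wpM2r ?exprn_ge0 // le_max lexx orbT].
have SigmaT : Sigma^T = Sigma by exact: (var_posdef y_var).1.
have Scvg : (fun j => Phi_sum A j.+1) @ \oo --> Phi_lim A.
  by have := Phi_sum_cvg rho0 rho1 Cu Cg; rewrite -cvg_shiftS.
have -> : (Jgk *m var_mean nu A) k 0 = (row_k k *m (Phi_lim A *m nu)) 0 0.
  by rewrite /var_mean (Phi_limE (o := Ordinal p_ge1)) // -row_mul [RHS]mxE.
have -> : (Jgk *m (Gamma0 A Sigma + 2 *: Gamma A Sigma) *m Jgk^T) k k =
    (row_k k *m Phi_lim A *m Sigma *m (row_k k *m Phi_lim A)^T) 0 0.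
  rewrite -(long_run_variance rho0 rho1 Cu Cg) // -row_mul !mxE.
  by apply: eq_bigr => j _; rewrite !mxE.
have rS : (fun j => row_k k *m Phi_sum A j.+1) @ \oo --> row_k k *m Phi_lim A.
  by apply: cvg_mulmx => //; exact: cvg_cst.
apply: cvgD; last first.
  apply: cvgM; first exact: cvg_cst.
  suff /mx_cvgP : (fun j => row_k k *m Phi_sum A j.+1 *m Sigma *m
      (row_k k *m Phi_sum A j.+1)^T) @ \oo -->
      row_k k *m Phi_lim A *m Sigma *m (row_k k *m Phi_lim A)^T by apply.
  apply: cvg_mulmx; last exact: cvg_trmx.
  by apply: cvg_mulmx => //; exact: cvg_cst.
suff /mx_cvgP : (fun j => row_k k *m forecast nu A y t j w) @ \oo -->
    row_k k *m (Phi_lim A *m nu) by apply.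
apply: cvg_mulmx; first exact: cvg_cst.
(* The contribution of the lagged values dies out with the powers of C; only the one of [nu]
   survives. *)
rewrite -[Phi_lim A *m nu]add0r; apply: cvgD; last first.
  by apply: cvg_mulmx => //; exact: cvg_cst.
have := geometric_mx_cvg0 rho0 rho1 (geometric_mx_S rho0 Cg).
move=> C0; rewrite -[0 in X in _ --> X](mul0mx _ (lagged p y t w)).
apply: cvg_mulmx; last exact: cvg_cst.
rewrite -[0 in X in _ --> X](mulmx0 _ (selJ R (m + m + l) p)).
by apply: cvg_mulmx => //; exact: cvg_cst.
Qed.

Lemma price_series_cvg k :
  (Jgk *m var_mean nu A) k 0
    + (Jgk *m (2^-1 *: Gamma0 A Sigma + Gamma A Sigma) *m Jgk^T) k k < 0 ->
  {ae P, forall w, cvgn (series (fun q => price_term P y dt t k q.+1 w))}.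
Proof.
(* The null sets, one for each q, are merged before the sample point is fixed. *)
move=> neg; have := ae_foralln (fun q => price_moments k q.+1).
apply: filterS => w moments.
pose e j := (row_k k *m forecast nu A y t j w) 0 0 + 2^-1 * variance_term k j.+1.
apply: (@series_le_cvg _ _ (fun q => expR (dt t w k 0 + \sum_(j < q.+1) e j))).
- by move=> q; exact: expR_ge0.
- by move=> q; exact: expR_ge0.
- move=> q; rewrite /price_term ler_expR; have [-> var_le] := moments q.
  by rewrite -addrA lerD2l big_split /= -mulr_sumr lerD2l ler_pM2l.
- apply: (@exp_sum_series_cvg _ _ (dt t w k 0) _ (@exponent_cvg 2^-1 k w)).
  move: neg; congr (_ + _ < _).
  (* This factorization identifies the assumed negative quantity with the limit for weight 1/2. *)
  have -> : 2^-1 *: Gamma0 A Sigma + Gamma A Sigma =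
      2^-1 *: (Gamma0 A Sigma + 2 *: Gamma A Sigma).
    by rewrite scalerDr scalerA mulVf ?pnatr_eq0 // scale1r.
  by rewrite -scalemxAr -scalemxAl mxE.
Qed.

Lemma mixed_series_cvg k1 k2 :
  let crit := fun k => (Jgk *m var_mean nu A) k 0
    + (Jgk *m (Gamma0 A Sigma + 2 *: Gamma A Sigma) *m Jgk^T) k k in
  crit k1 < 0 -> crit k2 < 0 ->
  {ae P, forall w,
    double_series_cvg (fun q1 q2 => mixed_term P y dt t k1 k2 q1.+1 q2.+1 w)}.
Proof.
move=> crit neg1 neg2.
have := ae_foralln (fun q1 => ae_foralln (fun q2 => mixed_moments k1 k2 q1.+1 q2.+1)).
apply: filterS => w moments.
pose e k j := (row_k k *m forecast nu A y t j w) 0 0 + 1 * variance_term k j.+1.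
pose u k q := expR (dt t w k 0 + \sum_(j < q.+1) e k j).
have cu k : crit k < 0 -> cvgn (series (u k)).
  move=> neg; apply: (@exp_sum_series_cvg _ _ (dt t w k 0) _ (@exponent_cvg 1 k w)).
  by rewrite mul1r.
apply: (@double_series_cvg_le _ _ (u k1) (u k2)); try by move=> *; exact: expR_ge0.
(* Half of the bound 2 Var X + 2 Var Y leaves weight 1 on each variance, and the exponential splits
   into a factor in [q1] and one in [q2]. *)
- move=> q1 q2; rewrite expR_ge0 /= -expRD ler_expR.
  have [-> var_le] := moments q1 q2.
  rewrite !big_split /= -!mulr_sumr !mul1r.
  set D1 := dt _ _ _ _; set D2 := dt _ _ _ _.
  set V := cond_var _ _ _ _ in var_le *.
  move: var_le; rewrite /forecast_mean; lra.
- exact: cu.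
- exact: cu.
Qed.

End StockPrice.

Theorem proposition2 (disp : measure_display) (T : measurableType disp)
    (R : realType) (P : probability T R)
    (m l p : nat) (m_ge1 : (1 <= m)%N) (p_ge1 : (1 <= p)%N)
    (nu : 'cV[R]_(m + m + l)) (A : 'I_p -> 'M[R]_(m + m + l))
    (Sigma : 'M[R]_(m + m + l))
    (xi : nat -> T -> 'cV[R]_(m + m + l))
    (y : int -> T -> 'cV[R]_(m + m + l))
    (dt : nat -> T -> 'cV[R]_m)
    (y_var : gaussian_var P nu A Sigma xi y)
    (dt_div : log_dividends y dt)
    (xi_indep : forall s : nat,
       sigma_independent P (information dt y s) (future_noise xi s))
    (A_distinct : distinct_eigenvalues (companion A))
    (A_stable : eigenvalues_in_unit_disc (companion A))
    (t : nat)
    (lagged_known : sigma_vec (lagged p y t) `<=` information dt y t)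
    (i i1 i2 : 'I_m) :
  let mu := var_mean nu A in
  let G0 := Gamma0 A Sigma in
  let G := Gamma A Sigma in
  let crit := fun k : 'I_m =>
    (Jgk *m mu) k 0 + (Jgk *m (G0 + 2 *: G) *m Jgk^T) k k in
  ((Jgk *m mu) i 0 + (Jgk *m (2^-1 *: G0 + G) *m Jgk^T) i i < 0 ->
     {ae P, forall w : T,
        cvgn (series (fun q : nat => price_term P y dt t i q.+1 w))}) /\
  (Num.max (crit i1) (crit i2) < 0 ->
     {ae P, forall w : T,
        double_series_cvg
          (fun q1 q2 : nat => mixed_term P y dt t i1 i2 q1.+1 q2.+1 w)}).
Proof.
move=> mu G0 G crit; split.
  exact: (price_series_cvg p_ge1 y_var dt_div xi_indep A_distinct A_stable
    lagged_known).
rewrite gt_max => /andP[neg1 neg2].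
exact: (mixed_series_cvg p_ge1 y_var dt_div xi_indep A_distinct A_stable
  lagged_known neg1 neg2).
Qed.
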